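(* Let $k\ge 2$ be an integer and $0\le\alpha\le 1$. Let $K\subset\mathbb{R}^n$ be a compact convex set whose interior contains the origin, such that $\partial K$ is $C^{k,\alpha}$ and its principal curvatures are positive at every point. Let $U\subset\mathbb{R}^n$ be a bounded open set with $C^{k,\alpha}$ boundary. Let $\varphi:\mathbb{R}^n\to\mathbb{R}$ be a $C^{k,\alpha}$ function with $\gamma^{\circ}(D\varphi)<1$ everywhere. Then $$R_\rho=\overline{R}_{\rho,0}.$$
   Context: Gauge and polar: $\gamma(x):=\inf\{t>0: x\in tK\}$ is the gauge function of $K$; $K^{\circ}:=\{x:\langle x,z\rangle\le 1 \text{ for all } z\in K\}$ is the polar of $K$; $\gamma^{\circ}$ is the gauge function of $K^{\circ}$. Obstacle: $\rho(x):=\min_{z\in\partial U}[\gamma(x-z)+\varphi(z)]$. A point $z\in\partial U$ is called a $\rho$-closest point to $x$ on $\partial U$ if $\rho(x)=\gamma(x-z)+\varphi(z)$. The $\rho$-ridge $R_\rho$ is the set of all $x\in U$ such that $\rho$ is not $C^{1,1}$ in any neighborhood of $x$. $R_{\rho,0}$ is the set of points of $U$ with more than one $\rho$-closest point on $\partial U$, and $\overline{R}_{\rho,0}$ is its closure. *)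

(* Defs.v *)
From HB Require Import structures.
From mathcomp Require Import all_boot all_order all_algebra.
From mathcomp Require Import all_classical all_reals all_analysis.
Import Order.TTheory GRing.Theory Num.Theory.
Import numFieldNormedType.Exports.

Set Implicit Arguments.
Unset Strict Implicit.
Unset Printing Implicit Defensive.

Local Open Scope classical_set_scope.
Local Open Scope ring_scope.

(* 'rV[R]_n carries the sup norm; the Euclidean structure of R^n, on which the
   polar and the curvatures depend, is given by [dot] and [enorm]. *)
Definition dot (R : realType) (n : nat) (x y : 'rV[R]_n) : R :=
  \sum_(i < n) x ord0 i * y ord0 i.

Definition enorm (R : realType) (n : nat) (x : 'rV[R]_n) : R :=
  Num.sqrt (dot x x).

Definition partial (R : realType) (n : nat) (i : 'I_n) (f : 'rV[R]_n -> R)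
  (x : 'rV[R]_n) : R := 'D_(delta_mx ord0 i) f x.

Definition grad (R : realType) (n : nat) (f : 'rV[R]_n -> R) (x : 'rV[R]_n) :
  'rV[R]_n := \row_i partial i f x.

Definition locally_holder (R : realType) (n : nat) (alpha : R)
    (O : set 'rV[R]_n) (f : 'rV[R]_n -> R) : Prop :=
  forall x, O x -> exists2 r : R, 0 < r & exists M : R,
    forall y z, O y -> O z -> ball x r y -> ball x r z ->
      `|f y - f z| <= M * `|y - z| `^ alpha.

(* f is of class C^{k,alpha} on the open set O: all partial derivatives of order
   at most k exist and are continuous on O, and those of order k are locally
   alpha-Hoelder.  For alpha = 0 the Hoelder condition is local boundedness
   (0 `^ 0 = 1), so C^{k,0} is C^k; for alpha = 1 it is a local Lipschitz
   condition.  All norms being equivalent, the sup norm is harmless here. *)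
Fixpoint holder_class (R : realType) (n k : nat) (alpha : R)
    (O : set 'rV[R]_n) (f : 'rV[R]_n -> R) : Prop :=
  (forall x, O x -> {for x, continuous f}) /\
  match k with
  | 0%N => locally_holder alpha O f
  | k'.+1 => forall i : 'I_n,
      (forall x, O x -> derivable f x (delta_mx ord0 i)) /\
      holder_class k' alpha O (partial i f)
  end.

Definition boundary (T : topologicalType) (A : set T) : set T :=
  closure A `\` interior A.

(* The boundary of A is C^{k,alpha}: near each boundary point, after relabelling
   (choice of i) and reorienting (sign (-1) ^+ b) the coordinate axes, the
   boundary is the graph of a C^{k,alpha} function g of the n - 1 remaining
   coordinates, the interior of A lying on one side of that graph. *)
Definition holder_boundary (R : realType) (n k : nat) (alpha : R)
    (A : set 'rV[R]_n) : Prop :=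
  forall x, boundary A x ->
    exists (i : 'I_n) (b : bool) (g : 'rV[R]_n.-1 -> R),
      holder_class k alpha setT g /\
      \forall y \near x,
        (interior A y <-> g (col' i y) < (-1) ^+ b * y ord0 i) /\
        (boundary A y <-> g (col' i y) = (-1) ^+ b * y ord0 i).

(* F is a C^2 defining function of A on V, negative inside. *)
Definition defining_function (R : realType) (n : nat) (A V : set 'rV[R]_n)
    (F : 'rV[R]_n -> R) : Prop :=
  holder_class 2 0 V F /\
  forall y, V y -> [/\ grad F y != 0,
    interior A y <-> F y < 0 & boundary A y <-> F y = 0].

Definition unit_normal (R : realType) (n : nat) (F : 'rV[R]_n -> R)
  (y : 'rV[R]_n) : 'rV[R]_n := (enorm (grad F y))^-1 *: grad F y.

(* The principal curvatures of the boundary of A at x are the eigenvalues of the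
   Weingarten map v |-> D_v nu on the tangent space at x, where nu is the outward
   unit normal.  The map does not depend on the defining function used to extend
   nu off the boundary.  With this orientation spheres have positive
   curvatures. *)
Definition principal_curvature (R : realType) (n : nat) (A : set 'rV[R]_n)
    (x : 'rV[R]_n) (kappa : R) : Prop :=
  boundary A x /\
  exists (V : set 'rV[R]_n) (F : 'rV[R]_n -> R),
    [/\ open V, V x, defining_function A V F &
      exists v : 'rV[R]_n, [/\ v != 0, dot v (unit_normal F x) = 0 &
        'D_v (unit_normal F) x = kappa *: v]].

Definition gauge (R : realType) (n : nat) (K : set 'rV[R]_n) (x : 'rV[R]_n) : R :=
  inf [set t : R | 0 < t /\ exists2 y, K y & x = t *: y].

Definition polar (R : realType) (n : nat) (K : set 'rV[R]_n) : set 'rV[R]_n :=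
  [set x | forall z, K z -> dot x z <= 1].

Section Obstacle.
Context (R : realType) (n : nat) (K U : set 'rV[R]_n) (phi : 'rV[R]_n -> R).

(* The infimum is a minimum when the boundary of U is compact and nonempty, K is
   a convex body with 0 in its interior, and phi is continuous. *)
Definition rho (x : 'rV[R]_n) : R :=
  inf [set gauge K (x - z) + phi z | z in boundary U].

Definition rho_closest (x z : 'rV[R]_n) : Prop :=
  boundary U z /\ rho x = gauge K (x - z) + phi z.

Definition rho_ridge : set 'rV[R]_n :=
  [set x | U x /\ ~ exists V : set 'rV[R]_n,
     [/\ open V, V x & holder_class 1 1 V rho]].

Definition rho_ridge0 : set 'rV[R]_n :=
  [set x | U x /\ exists z1 z2,
     [/\ z1 <> z2, rho_closest x z1 & rho_closest x z2]].

End Obstacle.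

(* Main.v *)
(* Two closest points of x lie on distinct rays through x, so rho, being touched
   from above at x by two smooth functions with distinct gradients, is not
   differentiable there.  Conversely, near a point away from the closure of
   R_{rho,0}, a closest point z of x is still a closest point of every
   x + s w with w the unit vector of the ray from z to x and s small: otherwise
   rho could not keep increasing at unit speed.  Then rho is touched at x from
   above by gamma(. - z) + phi(z) and from below by
   rho(x + s w) - gamma(x + s w - .), with uniform second order bounds, hence it
   is C^{1,1}.  Finally R_{rho,0} does not accumulate at the boundary of U:
   there the second derivative of gamma(x - .) in the directions tangent to the
   boundary is of order 1 / gamma(x - z), by uniform convexity of K, and
   dominates the curvature of the boundary and the Hessian of phi. *)
Require Import Defs.
From HB Require Import structures.
From mathcomp Require Import all_boot all_order all_algebra.
From mathcomp Require Import all_classical all_reals all_analysis.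
From mathcomp Require Import ring lra.
Import Order.TTheory GRing.Theory Num.Theory.
Import numFieldNormedType.Exports.

Set Implicit Arguments.
Unset Strict Implicit.
Unset Printing Implicit Defensive.

Local Open Scope classical_set_scope.
Local Open Scope ring_scope.

(** * Inner product and norms *)

(** The gauge is never differentiated. Its regularity is carried by inequalities: a point [w] with
    [g w = 1] has a normal [p] with [g (t w + h) <= t + p.h + (m / t) |h|^2] and
    [|g(u) w - u|^2 <= m g(u) (g(u) - p.u)], where one constant [m] serves all [w] by compactness of
    the boundary of [K]. They are derived in a chart whose defining function [F] is affine, with
    slope of modulus 1, along one coordinate axis: an exact translation along that axis moves a
    nearby point onto the boundary, which replaces the implicit function theorem. Positive curvature
    is used once, to make the Hessian of [F] definite on the tangent space. The condition on the
    gradient of [phi] is used in two forms. Integrated, it reads [phi x - phi y < g (x - y)]: every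
    boundary point of [U] is its own only closest point, and two closest points never share a ray.
    Pointwise, near the boundary of [U], it makes the rays to closest points uniformly transversal
    to that boundary. The ridge is a subset of [U] by definition, whereas a closure could reach the
    boundary of [U]; this is why uniqueness near the boundary must be proved. *)

Section Dot.
Context {R : realType} {n : nat}.
Implicit Types x y p u : 'rV[R]_n.

Lemma dotC x y : dot x y = dot y x.
Proof. by apply: eq_bigr => i _; rewrite mulrC. Qed.

Lemma dotDl x y u : dot (x + y) u = dot x u + dot y u.
Proof. by rewrite /dot -big_split; apply: eq_bigr => i _; rewrite mxE mulrDl. Qed.

Lemma dotZl a x u : dot (a *: x) u = a * dot x u.
Proof. by rewrite /dot mulr_sumr; apply: eq_bigr => i _; rewrite mxE mulrA. Qed.

Lemma dotDr u x y : dot u (x + y) = dot u x + dot u y.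
Proof. by rewrite dotC dotDl !(dotC u). Qed.

Lemma dotZr a u x : dot u (a *: x) = a * dot u x.
Proof. by rewrite dotC dotZl dotC. Qed.

Lemma dotNl x u : dot (- x) u = - dot x u.
Proof. by rewrite -scaleN1r dotZl mulN1r. Qed.

Lemma dotNr u x : dot u (- x) = - dot u x.
Proof. by rewrite dotC dotNl dotC. Qed.

Lemma dotBl x y u : dot (x - y) u = dot x u - dot y u.
Proof. by rewrite dotDl dotNl. Qed.

Lemma dotBr u x y : dot u (x - y) = dot u x - dot u y.
Proof. by rewrite dotDr dotNr. Qed.

Lemma dot0l u : dot 0 u = 0.
Proof. by rewrite -(scale0r 0) dotZl mul0r. Qed.

Lemma dot0r u : dot u 0 = 0.
Proof. by rewrite dotC dot0l. Qed.

Lemma dot_delta p i : dot p (delta_mx ord0 i) = p ord0 i.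
Proof.
rewrite /dot (bigD1 i)//= big1 ?addr0 => [|j ji]; rewrite mxE ?eqxx ?mulr1//.
by rewrite (negPf ji) andbF mulr0.
Qed.

Lemma coord_le_norm x i : `|x ord0 i| <= `|x|.
Proof.
rewrite [leRHS]/Num.norm /= mx_normrE; apply/bigmax_geP; right => /=.
by exists (ord0, i).
Qed.

Lemma norm_le_coord x c :
  0 <= c -> (forall i, `|x ord0 i| <= c) -> `|x| <= c.
Proof.
move=> c0 xc; rewrite [leLHS]/Num.norm /= mx_normrE; apply/bigmax_leP; split => //.
by move=> [i j] _ /=; rewrite (ord1 i).
Qed.

Lemma norm_lt_coord x c :
  0 < c -> (forall i, `|x ord0 i| < c) -> `|x| < c.
Proof.
move=> c0 xc; rewrite [ltLHS]/Num.norm /= mx_normrE; apply/bigmax_ltP; split => //.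
by move=> [i j] _ /=; rewrite (ord1 i).
Qed.

Lemma norm_delta_rV i : `|delta_mx ord0 i : 'rV[R]_n| = 1.
Proof.
apply/eqP; rewrite eq_le; apply/andP; split.
  apply: norm_le_coord => // j; rewrite mxE eqxx /=.
  by case: (j == i); rewrite ?normr1 ?normr0.
by apply: le_trans (coord_le_norm _ i); rewrite mxE !eqxx normr1.
Qed.

Lemma dot_le x y : `|dot x y| <= n%:R * (`|x| * `|y|).
Proof.
apply: le_trans (ler_norm_sum _ _ _) _.
rewrite -[n in n%:R]card_ord -sum1_card natr_sum mulr_suml.
apply: ler_sum => i _; rewrite mul1r normrM.
by apply: ler_pM => //; apply: coord_le_norm.
Qed.

Lemma norm_sqr_le_dot x : `|x| ^+ 2 <= dot x x.
Proof.
have dge0 : 0 <= dot x x by apply: sumr_ge0 => i _; rewrite -expr2 sqr_ge0.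
rewrite -(sqr_sqrtr dge0) ler_sqr ?nnegrE ?sqrtr_ge0//.
apply: norm_le_coord; first exact: sqrtr_ge0.
move=> i; rewrite -sqrtr_sqr ler_wsqrtr// expr2 /dot (bigD1 i)//= lerDl.
by apply: sumr_ge0 => j _; rewrite -expr2 sqr_ge0.
Qed.

Lemma dot_self_eq0 x : dot x x = 0 -> x = 0.
Proof.
move=> h; have := norm_sqr_le_dot x; rewrite h => h2.
apply/eqP; rewrite -normr_eq0 -sqrf_eq0; apply/eqP/le_anti.
by rewrite h2 sqr_ge0.
Qed.

End Dot.

(** * Directional derivatives as linear error bounds *)

Section DerivativeEps.
Context {R : realType} {V W : normedModType R}.
Implicit Types (f : V -> W) (x v : V) (l : W).

(** Multiplying the difference quotient by [h] turns the punctured neighbourhood into a full one,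
    the bound being trivial at [h = 0]. *)
Lemma is_derive_epsP f x v l :
  is_derive x v f l <->
  forall e : R, 0 < e ->
    \forall h \near (0 : R), `|f (h *: v + x) - f x - h *: l| <= e * `|h|.
Proof.
pose q h : W := h^-1 *: ((f \o shift x) (h *: v) - f x).
have -> : is_derive x v f l <-> (q h @[h --> 0^'] --> l).
  split=> [[dfx <-] //|ql]; split; first by apply/cvg_ex; exists l.
  exact: cvg_lim ql.
rewrite cvgrPdist_le; split=> H e e0; have := H e e0.
  rewrite !near_withinE; apply: filterS => h hP.
  have [->|h0] := eqVneq h 0.
    by rewrite scale0r add0r subrr scale0r subrr !normr0 mulr0.
  have := hP h0; rewrite -(ler_pM2r (_ : 0 < `|h|)) ?normr_gt0// => hP'.
  by rewrite (_ : _ - h *: l = - (h *: (l - q h)))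
    ?normrN ?normrZ 1?mulrC// scalerBr /q scalerA divff// scale1r opprB.
rewrite !near_withinE; apply: filterS => h hP h0.
rewrite -(ler_pM2r (_ : 0 < `|h|)) ?normr_gt0//; apply: le_trans hP.
by rewrite (_ : _ - h *: l = - (h *: (l - q h)))
  ?normrN ?normrZ 1?mulrC// scalerBr /q scalerA divff// scale1r opprB.
Qed.

End DerivativeEps.

Lemma is_derive_line {R : realType} {V W : normedModType R} (f : V -> W)
    (x v : V) (s : R) (l : W) :
  is_derive (x + s *: v) v f l -> is_derive s 1 (fun t => f (x + t *: v)) l.
Proof.
move=> /is_derive_epsP H; apply/is_derive_epsP => e /H; apply: filterS => h.
by rewrite [_ *: 1]mulr1 scalerDl addrCA.
Qed.

Lemma is_derive_scale {R : realType} {V W : normedModType R} (f : V -> W)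
    (x v : V) (a : R) (l : W) :
  is_derive x v f l -> is_derive x (a *: v) f (a *: l).
Proof.
have [->|a0] := eqVneq a 0; first by rewrite !scale0r => _; exact: is_derive0.
move=> /is_derive_epsP H; apply/is_derive_epsP => e e0.
have /H : 0 < e / `|a| by rewrite divr_gt0// normr_gt0.
move=> /nbhs_norm0P[d/= d0 Hd]; apply/nbhs_norm0P.
exists (d / `|a|) => /=; first by rewrite divr_gt0// normr_gt0.
move=> h; rewrite /= ltr_pdivlMr ?normr_gt0// -normrM => /Hd.
have hE : e / `|a| * `|h * a| = e * `|h|.
  by rewrite normrM; field; rewrite normr_eq0.
by rewrite hE !scalerA.
Qed.

Lemma mean_value_01 {R : realType} (f df : R -> R) (c e : R) :
  (forall s : R, is_derive s (1 : R) f (df s)) ->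
  (forall s : R, 0 <= s <= 1 -> `|df s - c| <= e) ->
  `|f 1 - f 0 - c| <= e.
Proof.
move=> H He; have cf : {within `[0, 1], continuous f}.
  apply: continuous_subspaceT => s; apply: differentiable_continuous.
  by apply/derivable1_diffP; case: (H s).
have [s] := MVT_segment ler01 (fun s _ => H s) cf.
by rewrite in_itv /= => /He hs ->; rewrite subr0 mulr1.
Qed.

Lemma near_distP {R : realType} {V : normedModType R} (x : V) (P : V -> Prop) :
  (\forall y \near x, P y) <->
  exists2 r : R, 0 < r & forall y, `|y - x| < r -> P y.
Proof.
split=> [/nbhs_ballP[r /= r0 H]|[r r0 H]].
  by exists r => // y yr; apply: H; rewrite -ball_normE /= distrC.
apply/nbhs_ballP; exists r => // y; rewrite -ball_normE /= distrC; exact: H.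
Qed.

Lemma continuous_distP {R : realType} {V W : normedModType R} (f : V -> W) x :
  {for x, continuous f} <->
  forall e : R, 0 < e ->
    exists2 r : R, 0 < r & forall y, `|y - x| < r -> `|f y - f x| <= e.
Proof.
split=> [/cvgrPdist_le H e /H/near_distP[r r0 Hr]|H].
  by exists r => // y /Hr; rewrite distrC.
apply/cvgrPdist_le => e /H[r r0 Hr]; apply/near_distP; exists r => // y /Hr.
by rewrite distrC.
Qed.

Lemma is_derive_affine {R : realType} {V W : normedModType R} (f : V -> W)
    (x v : V) (l : W) :
  (forall h : R, f (h *: v + x) - f x = h *: l) -> is_derive x v f l.
Proof.
move=> H; apply/is_derive_epsP => e e0; apply/near_distP; exists 1 => // h _.
by rewrite H subrr normr0 mulr_ge0// ltW.
Qed.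

(** * First and second order Taylor estimates *)

Section Partials.
Context {R : realType} {n : nat}.
Implicit Types (f : 'rV[R]_n -> R) (x y d : 'rV[R]_n).

(** The path from [y] to [y + d] is a staircase along the axes, and the one-variable mean value
    theorem applies to each of its [n] steps; hence the factor [n]. *)
Lemma partials_mean_value f x0 (r : R) (a : 'rV[R]_n) (e : R) y d :
  (forall i x, derivable f x (delta_mx ord0 i)) ->
  (forall x, `|x - x0| < r -> forall i, `|partial i f x - a ord0 i| <= e) ->
  `|y - x0| < r -> `|y + d - x0| < r ->
  `|f (y + d) - f y - dot a d| <= n%:R * e * `|d|.
Proof.
move=> df He yr ydr.
have r0 : 0 < r by apply: le_lt_trans yr.
(* [P j] has its first [j] coordinates already moved to those of [y + d]. *)
pose P j : 'rV[R]_n := \row_k (y ord0 k + if (k < j)%N then d ord0 k else 0).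
have P0 : y = P 0%N by apply/rowP => k; rewrite mxE ltn0 addr0.
have Pn : y + d = P n by apply/rowP => k; rewrite !mxE ltn_ord.
have -> : f y = f (P 0%N) by rewrite -P0.
rewrite Pn -(telescope_sumr (fun j => f (P j)))// big_mkord -sumrB.
apply: le_trans (ler_norm_sum _ _ _) _.
rewrite -[n in n%:R]card_ord -sum1_card natr_sum !mulr_suml.
apply: ler_sum => i _; rewrite mul1r.
pose g (s : R) := f (P i + s *: (d ord0 i *: delta_mx ord0 i)).
have dg (s : R) : is_derive s (1 : R) g
    (d ord0 i * partial i f (P i + s *: (d ord0 i *: delta_mx ord0 i))).
  by apply: is_derive_line; apply: is_derive_scale; exact: derivableP.
have g0 : g 0 = f (P i) by rewrite /g scale0r addr0.
have g1 : g 1 = f (P i.+1).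
  rewrite /g scale1r; congr f; apply/rowP => k; rewrite !mxE eqxx /= ltnS.
  have [->|ki] := eqVneq k i; first by rewrite ltnn leqnn mulr1 addr0.
  rewrite mulr0 addr0 [in RHS]leq_eqVlt.
  by rewrite (negPf (ki : nat_of_ord k != nat_of_ord i)).
rewrite -g0 -g1; apply: mean_value_01 dg _ => s /andP[s0 s1].
rewrite [a _ _ * _]mulrC -mulrBr normrM mulrC.
apply: ler_pM => //; last exact: coord_le_norm.
(* A ball of the sup norm is a box, so the staircase stays in any ball that contains both ends. *)
apply: He; apply: norm_lt_coord => // k.
have yk := le_lt_trans (coord_le_norm _ k) yr.
have ydk := le_lt_trans (coord_le_norm _ k) ydr.
move: yk ydk; rewrite !mxE eqxx /= !ltr_norml => /andP[? ?] /andP[? ?].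
have [ki|ki] := eqVneq k i.
  rewrite -ki ltnn addr0 mulr1; have [d0|d0] := leP 0 (d ord0 k).
    have sd0 : 0 <= s * d ord0 k by nra.
    have sd1 : s * d ord0 k <= d ord0 k by nra.
    by apply/andP; split; lra.
  have sd0 : s * d ord0 k <= 0 by nra.
  have sd1 : d ord0 k <= s * d ord0 k by nra.
  by apply/andP; split; lra.
by rewrite !mulr0 addr0; case: ifP => _; rewrite ?addr0; apply/andP; split; lra.
Qed.

End Partials.

Section TwiceDifferentiable.
Context {R : realType} {n : nat}.
Implicit Types (f : 'rV[R]_n -> R) (x y d u v : 'rV[R]_n).

Definition C1 f := forall i, (forall x, derivable f x (delta_mx ord0 i)) /\
  continuous (partial i f).

Definition C2 f := C1 f /\ forall i, C1 (partial i f).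

Lemma holder_class_cont k (alpha : R) f :
  holder_class k alpha setT f -> continuous f.
Proof. by case: k => [|k] [cf _] x; exact: cf. Qed.

Lemma holder_class_C2 k (alpha : R) f :
  (2 <= k)%N -> holder_class k alpha setT f -> C2 f.
Proof.
case: k => [//|[//|k]] _ [_ H]; split=> i; have [df [cdf ddf]] := H i.
  by split=> [x|x]; [exact: df|exact: cdf].
move=> j; have [ddf' /holder_class_cont c] := ddf j.
by split=> // x; exact: ddf'.
Qed.

(** Strict differentiability: the gradient frozen at [x0] serves for every base point [y] near
    [x0]. *)
Lemma C1_strict f x0 (e : R) : C1 f -> 0 < e ->
  exists2 r : R, 0 < r & forall y d, `|y - x0| < r -> `|y + d - x0| < r ->
    `|f (y + d) - f y - dot (grad f x0) d| <= e * `|d|.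
Proof.
(* Dividing by [n + 1] absorbs the factor [n] and stays legitimate for [n = 0]. *)
move=> cf e0; pose e1 := e / n.+1%:R.
have e10 : 0 < e1 by rewrite divr_gt0.
have H i : \forall x \near x0, `|partial i f x0 - partial i f x| < e1.
  by have [_ /(_ x0)/cvgrPdist_lt] := cf i; exact.
have /near_distP[r r0 Hr] := filter_forall (nbhs_filter x0) H.
exists r => // y d yr ydr.
have He x : `|x - x0| < r -> forall i,
    `|partial i f x - (grad f x0) ord0 i| <= e1.
  by move=> xr i; rewrite mxE distrC ltW// Hr.
apply: le_trans (partials_mean_value (fun i => (cf i).1) He yr ydr) _.
rewrite ler_wpM2r// /e1 mulrCA ger_pMr// ler_pdivrMr// mul1r ler_nat.
exact: leqnSn.
Qed.

Lemma C1_is_derive f x v : C1 f -> is_derive x v f (dot (grad f x) v).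
Proof.
move=> cf; apply/is_derive_epsP => e e0.
have v0 : 0 < `|v| + 1 by rewrite ltr_wpDl.
have [r r0 Hr] := C1_strict x cf (divr_gt0 e0 v0).
apply/nbhs_norm0P; exists (r / (`|v| + 1)) => /=; first exact: divr_gt0.
move=> h /= hr.
have -> : h *: dot (grad f x) v = dot (grad f x) (h *: v) by rewrite dotZr.
rewrite [h *: v + x]addrC.
have hv : `|h *: v| <= `|h| * (`|v| + 1).
  by rewrite normrZ ler_wpM2l// lerDl.
apply: le_trans (Hr x (h *: v) _ _) _.
- by rewrite subrr normr0.
- by rewrite addrC addKr (le_lt_trans hv)// -ltr_pdivlMr.
- by rewrite mulrAC ler_pdivrMr// -mulrA ler_pM2l.
Qed.

Lemma C1_continuous f : C1 f -> continuous f.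
Proof.
move=> cf x; apply/continuous_distP => e e0.
have [r r0 Hr] := C1_strict x cf ltr01.
pose M := 1 + n%:R * `|grad f x|.
have M0 : 0 < M by rewrite ltr_wpDr// mulr_ge0.
exists (Num.min r (e / M)).
  by rewrite lt_min r0 divr_gt0.
move=> y; rewrite lt_min => /andP[yr ye].
have := Hr x (y - x); rewrite subrr normr0 [x + _]addrC subrK => /(_ r0 yr) H.
have := dot_le (grad f x) (y - x); rewrite mulrA => H2.
rewrite (_ : _ - _ = (f y - f x - dot (grad f x) (y - x))
  + dot (grad f x) (y - x)); last by rewrite subrK.
apply: le_trans (ler_normD _ _) _; apply: le_trans (lerD H H2) _.
by rewrite -mulrDl mulrC -ler_pdivlMr// ltW.
Qed.

(** This is the regularity that [defining_function] demands. With exponent 0 the Hoelder condition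
    only bounds the local oscillation, which continuity provides. *)
Lemma C2_holder_class f (O : set 'rV[R]_n) : C2 f -> holder_class 2 0 O f.
Proof.
move=> [cf ccf]; have lh (g : 'rV[R]_n -> R) : continuous g ->
    locally_holder 0 O g.
  move=> cg x _; have /cvgrPdist_lt/(_ 1 ltr01)/near_distP[r r0 Hr] := cg x.
  exists r => //; exists 2 => y z _ _.
  rewrite -!ball_normE /= ![`|x - _|]distrC => /Hr yr /Hr zr.
  rewrite powRr0 mulr1 -(subrKA (g x)) ltW//.
  apply: le_lt_trans (ler_normD _ _) _; rewrite [`|g y - _|]distrC.
  by rewrite (_ : 2 = 1 + 1)// ltrD.
split=> [x _|i]; first exact: C1_continuous.
split=> [x _|]; first exact: (cf i).1.
split=> [x _|j]; first exact: (cf i).2.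
split=> [x _|]; first exact: (ccf i j).1.
by split=> [x _|]; [exact: (ccf i j).2|apply: lh; exact: (ccf i j).2].
Qed.

Definition hess f x d : 'rV[R]_n := \row_i dot (grad (partial i f) x) d.

Lemma hessZ f x a d : hess f x (a *: d) = a *: hess f x d.
Proof. by apply/rowP => i; rewrite !mxE dotZr. Qed.

Lemma hessD f x u d : hess f x (u + d) = hess f x u + hess f x d.
Proof. by apply/rowP => i; rewrite !mxE dotDr. Qed.

Lemma C2_grad_strict f x0 (e : R) : C2 f -> 0 < e ->
  exists2 r : R, 0 < r & forall y d, `|y - x0| < r -> `|y + d - x0| < r ->
    `|grad f (y + d) - grad f y - hess f x0 d| <= e * `|d|.
Proof.
move=> [_ ccf] e0.
have H i : \forall r \near (0:R)^'+, forall y d, `|y - x0| < r ->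
    `|y + d - x0| < r ->
    `|partial i f (y + d) - partial i f y - dot (grad (partial i f) x0) d|
      <= e * `|d|.
  have [r r0 Hr] := C1_strict x0 (ccf i) e0.
  near=> s => y d ys yds; have sr : s < r by near: s; exact: nbhs_right_lt.
  by apply: Hr; apply: lt_trans sr.
have {}H := filter_forall (at_right_proper_filter 0) H.
have [r [r0 Hr]] : exists r : R, 0 < r /\ forall i y d,
    `|y - x0| < r -> `|y + d - x0| < r ->
    `|partial i f (y + d) - partial i f y - dot (grad (partial i f) x0) d|
      <= e * `|d|.
  near (0:R)^'+ => s; exists s; split; first by near: s; exact: nbhs_right_gt.
  by near: s.
exists r => // y d yr ydr; apply: norm_le_coord => [|i].
  by rewrite mulr_ge0// ltW.
by rewrite !mxE; exact: Hr.
Unshelve. all: by end_near. Qed.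

(** The gradient is taken at the moving point [y], the Hessian is frozen at [x0]: in this mixed form
    the estimate is uniform over the boundary points near [x0]. The mean value theorem is applied to
    [f] on the segment minus its quadratic model. *)
Lemma C2_taylor f x0 (e : R) : C2 f -> 0 < e ->
  exists2 r : R, 0 < r & forall y d, `|y - x0| < r -> `|y + d - x0| < r ->
    `|f (y + d) - f y - dot (grad f y) d - dot (hess f x0 d) d / 2|
      <= e * `|d| ^+ 2.
Proof.
move=> c2 e0; have c1 := c2.1; pose e1 := e / n.+1%:R.
have e10 : 0 < e1 by rewrite divr_gt0.
have [r r0 Hr] := C2_grad_strict x0 c2 e10.
exists r => // y d yr ydr.
set A := dot (grad f y) d; set B := dot (hess f x0 d) d.
pose g (s : R) := f (y + s *: d) - (s * A + s ^+ 2 * (B / 2)).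
have dg (s : R) : is_derive s (1 : R) g
    (dot (grad f (y + s *: d)) d - (A + s * B)).
  have H1 := is_derive_line (C1_is_derive (y + s *: d) d c1).
  have H2 : is_derive s (1 : R) (fun s : R => s * A + s ^+ 2 * (B / 2))
      (A + s * B).
    apply/is_derive_epsP => e' e'0.
    have B1 : 0 < `|B / 2| + 1 by rewrite ltr_wpDl.
    apply/nbhs_norm0P; exists (e' / (`|B / 2| + 1)); first exact: divr_gt0.
    move=> h /=; rewrite ltr_pdivlMr// => /ltW hh.
    rewrite [h *: 1]mulr1 (_ : h *: _ = h * (A + s * B))//.
    rewrite (_ : _ - _ = h * (h * (B / 2))); last by field.
    rewrite normrM mulrC ler_wpM2r//; apply: le_trans hh.
    by rewrite normrM ler_wpM2l// lerDl.
  exact: is_deriveB.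
have -> : f (y + d) - f y - A - B / 2 = g 1 - g 0 - 0.
  rewrite /g scale1r scale0r addr0; ring.
apply: mean_value_01 dg _ => s /andP[s0 s1]; rewrite subr0.
have -> : dot (grad f (y + s *: d)) d - (A + s * B) =
    dot (grad f (y + s *: d) - grad f y - hess f x0 (s *: d)) d.
  by rewrite !dotBl hessZ dotZl; rewrite -/A -/B; ring.
have sdd : `|s *: d| <= `|d| by rewrite normrZ ger0_norm// ler_piMl.
apply: le_trans (dot_le _ _) _.
have ysd : `|y + s *: d - x0| < r.
  rewrite (_ : _ - _ = (1 - s) *: (y - x0) + s *: (y + d - x0)); last first.
    by apply/rowP => i; rewrite !mxE; ring.
  apply: le_lt_trans (ler_normD _ _) _; rewrite !normrZ.
  rewrite !ger0_norm ?subr_ge0//.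
  case: (leP s (1/2)) => hs; last by nra.
  nra.
have H3 := Hr y (s *: d) yr ysd.
rewrite expr2 (_ : e = n.+1%:R * e1); last by rewrite /e1 mulrC divfK.
have H4 : `|grad f (y + s *: d) - grad f y - hess f x0 (s *: d)| <= e1 * `|d|.
  by apply: le_trans H3 _; rewrite ler_pM2l.
rewrite -mulrA; apply: ler_pM => //.
  by rewrite ler_nat.
by rewrite mulrA ler_wpM2r.
Qed.

(* Both sides are limits of the second difference of [f] at [x] along [t u] and
   [t v], divided by [t ^+ 2]. *)
Lemma hess_sym f x u v : C2 f -> dot (hess f x u) v = dot (hess f x v) u.
Proof.
suff H : forall u v, C2 f -> dot (hess f x u) v <= dot (hess f x v) u.
  by move=> cf; apply/le_anti; rewrite !H.
move=> {}u {}v c2; apply/ler_addgt0Pr => e e0.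
pose m := (1 + `|u| + `|v|); have m0 : 0 < m.
  by rewrite /m -addrA ltr_wpDr// addr_ge0.
(* [m] bounds [u], [v] and [u + v]; the factor [4 + 2 n] is twice the error factor [2 + n] of [key],
   which is used for both orders. *)
pose e1 := e / (m ^+ 2 * (4 + 2 * n%:R)).
have q0 : 0 < 4 + 2 * n%:R :> R by rewrite ltr_wpDr// mulr_ge0.
have e10 : 0 < e1 by rewrite divr_gt0// mulr_gt0// exprn_gt0.
have e1E : m ^+ 2 * e1 * (4 + 2 * n%:R) = e.
  by rewrite /e1; field; rewrite !gt_eqF.
clearbody e1.
have [r1 r10 H1] := C2_taylor x c2 e10.
have [r2 r20 H2] := C2_grad_strict x c2 e10.
pose t := Num.min r1 r2 / (2 * m).
have t0 : 0 < t by rewrite divr_gt0 ?mulr_gt0// lt_min r10.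
have tm : t * m < Num.min r1 r2.
  rewrite /t invfM mulrA -mulrA mulVf ?gt_eqF// mulr1.
  have : 0 < Num.min r1 r2 by rewrite lt_min r10.
  by move=> hh; lra.
have um : `|u| <= m by rewrite /m; have := normr_ge0 v; lra.
have vm : `|v| <= m by rewrite /m; have := normr_ge0 u; lra.
have uvm : `|u + v| <= m by rewrite /m; have := ler_normD u v; lra.
clearbody t m.
have small (w : 'rV[R]_n) : `|w| <= m ->
    `|x + t *: w - x| < r1 /\ `|x + t *: w - x| < r2.
  move=> wm; rewrite addrC addKr normrZ gtr0_norm//; apply/andP.
  by rewrite -lt_min; apply: le_lt_trans tm; rewrite ler_pM2l.
have [u1 u2] := small u um; have [v1 v2] := small v vm.
have [uv1 uv2] := small (u + v) uvm.
have x1 : `|x - x| < r1 by rewrite subrr normr0.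
have x2 : `|x - x| < r2 by rewrite subrr normr0.
have nt (w : 'rV[R]_n) : `|w| <= m -> `|t *: w| ^+ 2 <= t ^+ 2 * m ^+ 2.
  move=> wm; rewrite normrZ gtr0_norm// -exprMn lerXn2r ?nnegrE//.
  - by rewrite mulr_ge0// ltW.
  - by rewrite mulr_ge0// ltW.
  - by rewrite ler_pM2l.
(* Two Taylor expansions with increment [t z], at [x + t w] and at [x], cost one unit of error each;
   replacing the difference of the gradients by the Hessian costs [n] more. *)
have key (w z : 'rV[R]_n) : `|w| <= m -> `|z| <= m -> `|w + z| <= m ->
  `|f (x + t *: (w + z)) - f (x + t *: w) - f (x + t *: z) + f x
     - t ^+ 2 * dot (hess f x w) z| <= t ^+ 2 * m ^+ 2 * e1 * (2 + n%:R).
  move=> wm zm wzm; have [w1 w2] := small w wm; have [z1 z2] := small z zm.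
  have [wz1 wz2] := small _ wzm.
  have A1 := H1 _ (t *: z) w1; rewrite -(addrA x) -scalerDr in A1.
  have {}A1 := A1 wz1; have A2 := H1 _ (t *: z) x1 z1.
  have A3 := H2 _ (t *: w) x2 w2.
  have A4 := dot_le (grad f (x + t *: w) - grad f x - hess f x (t *: w)) (t *: z).
  have A5 : `|dot (grad f (x + t *: w) - grad f x - hess f x (t *: w)) (t *: z)|
     <= n%:R * (t ^+ 2 * m ^+ 2 * e1).
    apply: le_trans A4 _; apply: ler_wpM2l => //.
    have B1 := nt _ wm; have B2 := nt _ zm.
    have := normr_ge0 (t *: w); have := normr_ge0 (t *: z).
    move: A3 B1 B2; move: (`|t *: w|) (`|t *: z|) => a b.
    move=> A3 B1 B2 b0 a0; apply: le_trans (ler_wpM2r b0 A3) _.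
    have : a * b <= t ^+ 2 * m ^+ 2 by nra.
    by move=> ab; nra.
  have A6 : dot (grad f (x + t *: w) - grad f x - hess f x (t *: w)) (t *: z)
     = dot (grad f (x + t *: w)) (t *: z) - dot (grad f x) (t *: z)
       - t ^+ 2 * dot (hess f x w) z.
    by rewrite !dotBl hessZ dotZl !dotZr; ring.
  have B3 := nt _ zm.
  have B4 : e1 * `|t *: z| ^+ 2 <= t ^+ 2 * m ^+ 2 * e1.
    by rewrite mulrC ler_pM2r.
  move: A1 A2 A5; rewrite A6.
  move=> /le_trans/(_ B4) A1 /le_trans/(_ B4) A2 A5.
  move: A1 A2 A5; rewrite !ler_norml => /andP[? ?] /andP[? ?] /andP[? ?].
  by apply/andP; split; lra.
have K1 := key u v um vm uvm.
have vum : `|v + u| <= m by rewrite addrC.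
have K2 := key v u vm um vum.
have t20 : 0 < t ^+ 2 by rewrite exprn_gt0.
rewrite -(ler_pM2l t20) mulrDr -e1E.
move: K1 K2; rewrite [v + u]addrC !ler_norml => /andP[? ?] /andP[? ?].
by lra.
Qed.

End TwiceDifferentiable.

(** * Boundary charts *)

Section C2Closure.
Context {R : realType} {n : nat}.
Implicit Types (f g : 'rV[R]_n -> R).

Lemma partial_add f g i : C1 f -> C1 g ->
  partial i (fun x => f x + g x) = fun x => partial i f x + partial i g x.
Proof.
move=> cf cg; apply/funext => x.
exact: (deriveD (V := 'rV[R]_n) ((cf i).1 x) ((cg i).1 x)).
Qed.

Lemma C1_add f g : C1 f -> C1 g -> C1 (fun x => f x + g x).
Proof.
move=> cf cg i; split=> x.
  exact: (derivableD (V := 'rV[R]_n) ((cf i).1 x) ((cg i).1 x)).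
rewrite partial_add//; apply: (@cvgD _ _ _ (nbhs x)).
  exact: (cf i).2.
exact: (cg i).2.
Qed.

Lemma C2_add f g : C2 f -> C2 g -> C2 (fun x => f x + g x).
Proof.
move=> [cf ccf] [cg ccg]; split; first exact: C1_add.
by move=> i; rewrite (partial_add i cf cg); exact: C1_add (ccf i) (ccg i).
Qed.

Lemma is_derive_dot (p : 'rV[R]_n) i x :
  is_derive x (delta_mx ord0 i : 'rV[R]_n) (dot p) (p ord0 i).
Proof.
by apply: is_derive_affine => h; rewrite dotDr addrK dotZr dot_delta.
Qed.

Lemma C2_dot (p : 'rV[R]_n) : C2 (dot p).
Proof.
have H i : partial i (dot p) = fun=> p ord0 i.
  by apply/funext => x; have [] := is_derive_dot p i x.
split=> i.
  split=> [x|]; first by case: (is_derive_dot p i x).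
  by rewrite H => x; exact: cst_continuous.
rewrite H => j; split=> [x|]; first exact: (derivable_cst (V := 'rV[R]_n)).
rewrite (_ : partial j _ = fun=> 0); last first.
  by apply/funext => x; exact: (derive_cst (V := 'rV[R]_n)).
exact: (@cst_continuous _ _ (0 : R)).
Qed.

Lemma col'D (i : 'I_n) (x y : 'rV[R]_n) : col' i (x + y) = col' i x + col' i y.
Proof. by apply/rowP => j; rewrite !mxE. Qed.

Lemma col'Z (i : 'I_n) a (x : 'rV[R]_n) : col' i (a *: x) = a *: col' i x.
Proof. by apply/rowP => j; rewrite !mxE. Qed.

Lemma col'_delta (i : 'I_n) : col' i (delta_mx ord0 i : 'rV[R]_n) = 0.
Proof.
apply/rowP => j; rewrite !mxE eqxx /= (_ : lift i j == i = false)//.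
by apply/negP => /eqP /esym; exact/eqP/neq_lift.
Qed.

Lemma col'_delta_lift (i : 'I_n) j :
  col' i (delta_mx ord0 (lift i j) : 'rV[R]_n) = delta_mx ord0 j.
Proof. by apply/rowP => k; rewrite !mxE (inj_eq lift_inj). Qed.

Lemma col'_norm (i : 'I_n) (x : 'rV[R]_n) : `|col' i x| <= `|x|.
Proof. by apply: norm_le_coord => // j; rewrite mxE; exact: coord_le_norm. Qed.

Lemma continuous_comp_col' (i : 'I_n) (h : 'rV[R]_n.-1 -> R) :
  continuous h -> continuous (fun x : 'rV[R]_n => h (col' i x)).
Proof.
move=> ch x; apply/continuous_distP => e e0.
have [r r0 Hr] := (continuous_distP _ _).1 (ch (col' i x)) _ e0.
exists r => // y yx; apply: Hr; apply: le_lt_trans yx.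
by rewrite -scaleN1r -col'Z -col'D scaleN1r col'_norm.
Qed.

Lemma is_derive_comp_col' (i k : 'I_n) (h : 'rV[R]_n.-1 -> R) x : C1 h ->
  is_derive x (delta_mx ord0 k : 'rV[R]_n) (fun y => h (col' i y))
    (if unlift i k is Some j then partial j h (col' i x) else 0).
Proof.
move=> ch; case: unliftP => [j ->|->]; last first.
  apply: is_derive_affine => t.
  by rewrite col'D col'Z col'_delta !scaler0 add0r subrr.
apply/is_derive_epsP => e e0.
have /is_derive_epsP/(_ e e0) := derivableP ((ch j).1 (col' i x)).
by apply: filterS => t; rewrite col'D col'Z col'_delta_lift.
Qed.

Lemma partial_comp_col' (i k : 'I_n) (h : 'rV[R]_n.-1 -> R) : C1 h ->
  partial k (fun y => h (col' i y)) =
  fun x => if unlift i k is Some j then partial j h (col' i x) else 0.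
Proof.
by move=> ch; apply/funext => x; have [] := is_derive_comp_col' i k x ch.
Qed.

Lemma C1_comp_col' (i : 'I_n) (h : 'rV[R]_n.-1 -> R) :
  C1 h -> C1 (fun x => h (col' i x)).
Proof.
move=> ch k; split=> [x|]; first by case: (is_derive_comp_col' i k x ch).
rewrite partial_comp_col'//; case: unlift => [j|].
  exact/continuous_comp_col'/(ch j).2.
exact: (@cst_continuous _ _ (0 : R)).
Qed.

Lemma C2_comp_col' (i : 'I_n) (h : 'rV[R]_n.-1 -> R) :
  C2 h -> C2 (fun x => h (col' i x)).
Proof.
move=> [ch cch]; split; first exact: C1_comp_col'.
move=> k; rewrite partial_comp_col'//; case: unlift => [j|].
  exact/C1_comp_col'/cch.
have := (C2_dot 0).1; congr C1; apply/funext => x; exact: dot0l.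
Qed.

(* [F] vanishes on the boundary and is affine, with slope [- s], in the
   direction of the axis [i] over which the boundary is a graph. *)
Definition chart (A : set 'rV[R]_n) (x : 'rV[R]_n) (F : 'rV[R]_n -> R)
    (i : 'I_n) (s : R) :=
  [/\ C2 F, s * s = 1,
    forall y t, F (y + t *: delta_mx ord0 i) = F y - s * t &
    \forall y \near x, (interior A y <-> F y < 0) /\ (boundary A y <-> F y = 0)].

Lemma holder_boundary_chart k (alpha : R) (A : set 'rV[R]_n) x :
  (2 <= k)%N -> holder_boundary k alpha A -> boundary A x ->
  exists F i s, chart A x F i s.
Proof.
move=> k2 hA /hA [i [b [g [hg nA]]]].
pose s : R := (-1) ^+ b.
(* The function is [g (col' i y) - s * y_i]; its linear part is written with [dot] so that [C2_dot]
   applies. *)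
exists (fun y => g (col' i y) + dot (- s *: delta_mx ord0 i) y), i, s.
have E y : dot (- s *: delta_mx ord0 i) y = - (s * y ord0 i).
  by rewrite dotZl dotC dot_delta mulNr.
split.
- apply: C2_add; last exact: C2_dot.
  exact/C2_comp_col'/(holder_class_C2 k2 hg).
- by rewrite /s; case: (b); rewrite ?expr0 ?expr1 ?mulr1// mulrNN mulr1.
- move=> y t; rewrite !E col'D col'Z col'_delta scaler0 addr0 !mxE !eqxx /=.
  by rewrite mulr1 mulrDr opprD addrA.
- near=> y; rewrite E; have [intP bdP] : 
    (interior A y <-> g (col' i y) < s * y ord0 i) /\
    (boundary A y <-> g (col' i y) = s * y ord0 i) by near: y.
  rewrite subr_lt0; split=> //; rewrite bdP.
  by split=> [->|/subr0_eq//]; rewrite subrr.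
Unshelve. all: by end_near. Qed.

(** As [s * s = 1], this bounds the gradient of a chart below by 1 at every point of the space. *)
Lemma chart_grad (A : set 'rV[R]_n) x F i s y :
  chart A x F i s -> (grad F y) ord0 i = - s.
Proof.
move=> [[cF _] _ Fi _]; rewrite mxE.
suff : is_derive y (delta_mx ord0 i : 'rV[R]_n) F (- s) by case.
apply: is_derive_affine => h; rewrite [_ + y]addrC Fi.
by rewrite addrAC subrr add0r mulrC -mulrN.
Qed.

End C2Closure.

(** * The gauge of a convex body *)

Lemma convex_setP {R : realType} {V : lmodType R} (A : set V) :
  convex_set (A : set (convex_lmodType V)) ->
  forall x y (t : R), A x -> A y -> 0 <= t <= 1 -> A (t *: x + (1 - t) *: y).
Proof.
move=> cA x y t Ax Ay /andP[t0 t1].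
have := cA x y (Itv01 t0 t1); rewrite !inE => /(_ Ax Ay).
by [].
Qed.

Lemma bounded_setP {R : realType} {V : normedModType R} (A : set V) :
  bounded_set A -> exists2 M : R, 0 < M & forall x, A x -> `|x| <= M.
Proof.
move=> [M [_ HM]]; exists (`|M| + 1); first by rewrite ltr_wpDl.
by move=> x Ax; apply: (HM _ _ x Ax); rewrite (le_lt_trans (ler_norm _))// ltrDl.
Qed.

Record convex_body {R : realType} {n : nat} (K : set 'rV[R]_n) (r M : R) : Prop :=
  ConvexBody {
    body_closed : closed K;
    body_convex : forall x y (t : R),
      K x -> K y -> 0 <= t <= 1 -> K (t *: x + (1 - t) *: y);
    body_inner_gt0 : 0 < r;
    body_inner : forall x, `|x| < r -> K x;
    body_outer_gt0 : 0 < M;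
    body_outer : forall x, K x -> `|x| <= M }.

Section Gauge.
Context {R : realType} {n : nat} (K : set 'rV[R]_n) (r M : R).
Hypothesis body : convex_body K r M.
Let Kclosed := body_closed body.
Let Kconvex := body_convex body.
Let r0 := body_inner_gt0 body.
Let Kball := body_inner body.
Let M0 := body_outer_gt0 body.
Let Kbound := body_outer body.
Implicit Types (x y u p : 'rV[R]_n) (t s c : R).

Let K0 : K 0. Proof. by apply: Kball; rewrite normr0. Qed.

Let G x := [set t : R | 0 < t /\ exists2 y, K y & x = t *: y].

Let G_nonempty x : G x !=set0.
Proof.
have t0 : 0 < (`|x| + 1) / r by rewrite divr_gt0// ltr_wpDl.
exists ((`|x| + 1) / r); split=> //.
exists (((`|x| + 1) / r)^-1 *: x); last first.
  by rewrite scalerA divff ?scale1r// gt_eqF.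
apply: Kball; rewrite normrZ gtr0_norm ?invr_gt0// invf_div mulrAC.
by rewrite ltr_pdivrMr ?ltr_wpDl// ltr_pM2l// ltrDl.
Qed.

Let G_lbound x : has_lbound (G x).
Proof. by exists 0 => t [/ltW]. Qed.

Lemma gauge_ge0 x : 0 <= gauge K x.
Proof. by apply: lb_le_inf; [exact: G_nonempty|move=> t [/ltW]]. Qed.

Lemma gauge_le x t : 0 < t -> K (t^-1 *: x) -> gauge K x <= t.
Proof.
move=> t0 Kx; apply: ge_inf; [exact: G_lbound|]; split=> //; exists (t^-1 *: x) => //.
by rewrite scalerA divff ?scale1r// gt_eqF.
Qed.

Lemma gauge_lt x t : gauge K x < t -> K (t^-1 *: x).
Proof.
move=> /(inf_lt (G_nonempty x))[s [s0 [y Ky ->]] st].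
have t0 : 0 < t by apply: lt_trans st.
rewrite scalerA (_ : _ *: y = (t^-1 * s) *: y + (1 - t^-1 * s) *: 0).
  apply: Kconvex => //; apply/andP; split.
    by rewrite mulr_ge0// ?invr_ge0 ltW.
  by rewrite ler_pdivrMl// mulr1 ltW.
by rewrite scaler0 addr0.
Qed.

Lemma gauge0 : gauge K 0 = 0.
Proof.
apply/le_anti; rewrite gauge_ge0 andbT; apply/ler_addgt0Pr => e e0.
by rewrite add0r gauge_le// scaler0.
Qed.

(** The inner ball is open; the factor 2 puts the rescaled point at norm [r / 2], strictly
    inside. *)
Lemma gauge_le_norm x : gauge K x <= 2 / r * `|x|.
Proof.
have [->|x0] := eqVneq x 0; first by rewrite gauge0 normr0 mulr0.
have x0' : 0 < `|x| by rewrite normr_gt0.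
have h0 : 0 < 2 / r * `|x| by rewrite mulr_gt0// divr_gt0.
apply: gauge_le => //; apply: Kball; rewrite normrZ gtr0_norm ?invr_gt0//.
rewrite (_ : _ * _ = r / 2); last by field; rewrite !gt_eqF.
by rewrite ltr_pdivrMr// mulr_natr mulr2n ltrDl.
Qed.

Lemma norm_le_gauge x : `|x| <= M * gauge K x.
Proof.
rewrite mulrC -ler_pdivrMr//; apply/ler_addgt0Pr => e e0.
rewrite ler_pdivrMr//; set t := gauge K x + e.
have gt : gauge K x < t by rewrite ltrDl.
have t0 : 0 < t by rewrite (le_lt_trans (gauge_ge0 x)).
have := Kbound (gauge_lt gt).
by rewrite normrZ gtr0_norm ?invr_gt0// ler_pdivrMl.
Qed.

Lemma gauge_gt0 x : x != 0 -> 0 < gauge K x.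
Proof.
move=> x0; rewrite -(pmulr_rgt0 _ M0); apply: lt_le_trans (norm_le_gauge x).
by rewrite normr_gt0.
Qed.

Lemma gaugeZ x t : 0 <= t -> gauge K (t *: x) = t * gauge K x.
Proof.
have H s y : 0 < s -> gauge K (s *: y) <= s * gauge K y.
  move=> s0; rewrite mulrC -ler_pdivrMr//; apply/ler_addgt0Pr => e e0.
  set u := gauge K y + e.
  have gt : gauge K y < u by rewrite ltrDl.
  have u0 : 0 < u by rewrite (le_lt_trans (gauge_ge0 y)).
  rewrite ler_pdivrMr//; apply: gauge_le; first by rewrite mulr_gt0.
  rewrite scalerA (_ : _ * s = u^-1); first exact: gauge_lt.
  by field; rewrite !gt_eqF.
rewrite le_eqVlt => /predU1P[<-|t0]; first by rewrite scale0r gauge0 mul0r.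
apply/le_anti; rewrite H//=.
have t'0 : 0 < t^-1 by rewrite invr_gt0.
have := H t^-1 (t *: x) t'0.
by rewrite scalerA mulVf ?gt_eqF// scale1r ler_pdivlMl.
Qed.

Lemma gaugeD x y : gauge K (x + y) <= gauge K x + gauge K y.
Proof.
apply/ler_addgt0Pr => e e0; pose s := gauge K x + e / 2.
pose t := gauge K y + e / 2; have e20 : 0 < e / 2 by rewrite divr_gt0.
have gs : gauge K x < s by rewrite ltrDl.
have gt : gauge K y < t by rewrite ltrDl.
have s0 : 0 < s by rewrite (le_lt_trans (gauge_ge0 x)).
have t0 : 0 < t by rewrite (le_lt_trans (gauge_ge0 y)).
have -> : gauge K x + gauge K y + e = s + t by rewrite /s /t; field.
have st0 : 0 < s + t by rewrite addr_gt0.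
apply: gauge_le => //.
rewrite (_ : _ *: _ = (s / (s + t)) *: (s^-1 *: x)
    + (1 - s / (s + t)) *: (t^-1 *: y)).
  apply: Kconvex; try exact: gauge_lt.
  apply/andP; split; first by rewrite divr_ge0// ltW.
  by rewrite ler_pdivrMr// mul1r lerDl ltW.
rewrite scalerDr !scalerA; congr (_ *: _ + _ *: _); field.
  by rewrite !gt_eqF.
by rewrite !gt_eqF.
Qed.

Lemma dot_le_gauge p c u :
  0 <= c -> (forall k, K k -> dot p k <= c) -> dot p u <= c * gauge K u.
Proof.
move=> c0 H; apply/ler_addgt0Pr => e e0.
have c10 : 0 < c + 1 by rewrite ltr_wpDl.
(* The denominator is [c + 1] because [c] may vanish. *)
set t := gauge K u + e / (c + 1).
have gt : gauge K u < t by rewrite ltrDl divr_gt0.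
have t0 : 0 < t by rewrite (le_lt_trans (gauge_ge0 u)).
have := H _ (gauge_lt gt); rewrite dotZr ler_pdivrMl// => /le_trans; apply.
rewrite /t mulrDl mulrC lerD2l mulrAC ler_pdivrMr//.
by rewrite ler_pM2l// lerDl.
Qed.

(** Only gauge exactly 1 needs closedness: [x] is then a limit of points [x / (1 + d)] of gauge
    below 1. *)
Lemma gauge_le1_mem x : gauge K x <= 1 -> K x.
Proof.
rewrite le_eqVlt => /predU1P[x1|/gauge_lt]; last first.
  by rewrite invr1 scale1r.
rewrite (closure_id K).1//.
apply: contrapT => nK; have /near_distP[e e0 He] : \forall y \near x, ~ K y.
  have : nbhs x (~` K) by apply: open_nbhs_nbhs; split;
    [rewrite openC|rewrite (closure_id K).1//].
  by [].
pose d := e / (2 * (`|x| + 1)).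
have d0 : 0 < d by rewrite divr_gt0// mulr_gt0// ltr_wpDl.
apply: (He ((1 + d)^-1 *: x)); last by apply: gauge_lt; rewrite x1 ltrDl.
have d10 : 0 < 1 + d by rewrite addr_gt0.
rewrite -[X in _ - X]scale1r -scalerBl normrZ distrC ger0_norm; last first.
  by rewrite subr_ge0 invf_le1// lerDl ltW.
have -> : 1 - (1 + d)^-1 = d / (1 + d) by field; rewrite gt_eqF.
rewrite mulrAC ltr_pdivrMr//.
apply: (@le_lt_trans _ _ (d * (`|x| + 1))).
  by rewrite ler_pM2l// lerDl.
rewrite /d (_ : _ * _ = e / 2); last first.
  by field; rewrite gt_eqF// ltr_wpDl.
rewrite mulrDr mulr1 -/d; have : 0 < e * d by rewrite mulr_gt0.
by move=> ?; lra.
Qed.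

(** If [x] were interior, some [(1 + d) x] would still lie in [K], although its gauge is [1 + d] by
    homogeneity. *)
Lemma gauge1_boundary x : gauge K x = 1 -> boundary K x.
Proof.
move=> x1; split.
  by rewrite -(closure_id K).1//; apply: gauge_le1_mem; rewrite x1.
move=> /near_distP[e e0 He].
have d0 : 0 < e / (2 * (`|x| + 1)) by rewrite divr_gt0// mulr_gt0// ltr_wpDl.
set d := e / _ in d0.
have /gauge_le : K (1^-1 *: ((1 + d) *: x)).
  rewrite invr1 scale1r; apply: He.
  rewrite scalerDl scale1r [x + _]addrC addrK normrZ gtr0_norm//.
  rewrite mulrAC ltr_pdivrMr ?mulr_gt0// ?ltr_wpDl//.
  rewrite ltr_pM2l//; have := normr_ge0 x; lra.
move=> /(_ ltr01); rewrite gaugeZ ?addr_ge0 ?(ltW d0)// x1 mulr1; lra.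
Qed.

End Gauge.

(** The infimum being below 1, some admissible dilation factor [t] is below 1 too, and membership in
    [t] times the polar is the stated bound. *)
Lemma gauge_polar_lt1 {R : realType} {n : nat} (K : set 'rV[R]_n) (M : R) p :
  0 < M -> (forall x, K x -> `|x| <= M) -> gauge (polar K) p < 1 ->
  exists t : R, [/\ 0 < t, t < 1 & forall k, K k -> dot p k <= t].
Proof.
move=> M0 KM; pose T := n%:R * (`|p| * M) + 1.
have T0 : 0 < T by rewrite ltr_wpDl// !mulr_ge0// ltW.
(* Boundedness of [K] makes its polar absorbing; on an empty set the infimum would be a default
   value. *)
have ne : [set t : R | 0 < t /\ exists2 y, polar K y & p = t *: y] !=set0.
  exists T; split=> //; exists (T^-1 *: p); last first.
    by rewrite scalerA divff ?scale1r// gt_eqF.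
  move=> z /KM zM; rewrite dotZl ler_pdivrMl// mulr1 /T.
  apply: le_trans (ler_norm _) _; apply: le_trans (dot_le _ _) _.
  by rewrite ler_wpDr// ler_wpM2l// ler_wpM2l.
move=> /(inf_lt ne)[t [t0 [y Py ->]] t1]; exists t; split=> // k /Py yk.
by rewrite dotZl ger_pMr.
Qed.

(** * Uniform smoothness and convexity of the gauge *)

(** Normalization is Lipschitz away from the origin. The two Euclidean norms are compared through
    [|b|^2 - |a|^2 = (b - a).(b + a)], divided by a sum of norms that is at least 1. *)
Lemma normalize_dist {R : realType} {n : nat} (a b : 'rV[R]_n) :
  1 <= enorm a -> 1 <= enorm b ->
  `|(enorm a)^-1 *: a - (enorm b)^-1 *: b|
    <= `|a - b| * (1 + n%:R * (`|a| + `|b|) * `|b|).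
Proof.
move=> a1 b1; have a0 : 0 < enorm a by apply: lt_le_trans a1.
have b0 : 0 < enorm b by apply: lt_le_trans b1.
have esq (x : 'rV[R]_n) : enorm x ^+ 2 = dot x x.
  by rewrite sqr_sqrtr// (le_trans _ (norm_sqr_le_dot x))// exprn_ge0.
rewrite (_ : _ - _ = (enorm a)^-1 *: (a - b)
    + ((enorm a)^-1 - (enorm b)^-1) *: b); last first.
  by rewrite scalerBr scalerBl addrA subrK.
apply: le_trans (ler_normD _ _) _; rewrite !normrZ mulrDr mulr1 lerD//.
  by rewrite ler_piMl// gtr0_norm ?invr_gt0// invf_le1.
rewrite mulrA ler_wpM2r//.
have -> : (enorm a)^-1 - (enorm b)^-1
    = (enorm b - enorm a) / (enorm a * enorm b).
  by field; rewrite !gt_eqF.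
rewrite normrM [X in _ * X]gtr0_norm ?invr_gt0 ?mulr_gt0//.
have H : `|enorm b - enorm a| * (enorm a + enorm b)
    <= `|a - b| * (n%:R * (`|a| + `|b|)).
  rewrite -[X in _ * X <= _]gtr0_norm ?addr_gt0// -normrM.
  rewrite (_ : _ * _ = dot (b - a) (b + a)); last first.
    rewrite dotBl !dotDr [dot a b]dotC -!esq; ring.
  apply: le_trans (dot_le _ _) _; rewrite distrC mulrCA ler_wpM2l//.
  by rewrite ler_wpM2l// [`|a| + _]addrC ler_normD.
rewrite ler_pdivrMr ?mulr_gt0//.
apply: (@le_trans _ _ (`|a - b| * (n%:R * (`|a| + `|b|)))).
  by apply: le_trans H; rewrite ler_peMr//; lra.
by rewrite ler_peMr ?mulr_ge0// ?addr_ge0// -[1]mulr1 ler_pM.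
Qed.

(** * Curvature of a convex body read in a chart *)

Section ChartConvex.
Context {R : realType} {n : nat} (K : set 'rV[R]_n) (rK MK : R).
Hypothesis body : convex_body K rK MK.
Let Kclosed := body_closed body.
Let Kconvex := body_convex body.
Context (w0 : 'rV[R]_n) (F : 'rV[R]_n -> R) (i : 'I_n) (s : R).
Hypothesis KF : chart K w0 F i s.
Hypothesis Kw0 : boundary K w0.

Let C2F : C2 F. Proof. by case: KF. Qed.
Let ss : s * s = 1. Proof. by case: KF. Qed.

Lemma boundary_mem x : boundary K x -> K x.
Proof. by move=> [+ _]; rewrite -(closure_id K).1. Qed.

Lemma chart_mem : exists2 r : R, 0 < r & forall y, `|y - w0| < r ->
  [/\ interior K y <-> F y < 0, boundary K y <-> F y = 0 & K y <-> F y <= 0].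
Proof.
have [_ _ _ /near_distP[r r0 H]] := KF; exists r => // y /H[intP bdP].
split=> //; rewrite le_eqVlt; split=> [Ky|/predU1P[/bdP/boundary_mem//|]].
  have [/intP ->|ni] := pselect (interior K y); first by rewrite orbT.
  suff /bdP -> : boundary K y by rewrite eqxx.
  by split=> //; exact: subset_closure.
by move/intP/interior_subset.
Qed.

(** By convexity the segment from [w] to [u] stays in [K], so [F] starts at 0 and remains
    nonpositive along it; its derivative at [w] in that direction cannot be positive. *)
Lemma chart_support w u :
  F w = 0 -> (\forall y \near w, K y -> F y <= 0) -> K w -> K u ->
  dot (grad F w) (u - w) <= 0.
Proof.
move=> Fw /near_distP[r r0 Hr] Kw Ku; apply/ler_addgt0Pr => e e0; rewrite add0r.
have /is_derive_epsP/(_ e e0)/near_distP[d d0 Hd] :=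
  C1_is_derive w (u - w) C2F.1.
have v0 : 0 < `|u - w| + 1 by rewrite ltr_wpDl.
pose h := Num.min 1 (Num.min (d / 2) (r / (`|u - w| + 1))).
have h0 : 0 < h by rewrite !lt_min ltr01 !divr_gt0.
have h1 : h <= 1 by rewrite ge_min lexx.
have hd : h < d.
  apply: (@le_lt_trans _ _ (d / 2)); first by rewrite !ge_min lexx /= orbT.
  by rewrite ltr_pdivrMr// mulr_natr mulr2n ltrDl.
have hr : h * (`|u - w| + 1) <= r.
  by rewrite -ler_pdivlMr// !ge_min lexx !orbT.
have Fle : F (h *: (u - w) + w) <= 0.
  apply: Hr.
    rewrite addrK normrZ gtr0_norm//; apply: lt_le_trans hr.
    by rewrite ltr_pM2l// ltrDl.
  rewrite (_ : _ + _ = h *: u + (1 - h) *: w).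
    by apply: Kconvex; rewrite ?(ltW h0).
  by rewrite scalerBr scalerBl scale1r addrAC addrA.
have := Hd h; rewrite subr0 gtr0_norm// => /(_ hd).
rewrite Fw subr0 (_ : h *: _ = h * dot (grad F w) (u - w))//.
rewrite ler_norml => /andP[H _].
by rewrite -(ler_pM2l h0); move: H; rewrite lerBrDl mulrC; lra.
Qed.

(* Sliding [w0 + t v] along the axis [i] back onto the graph gives a point of
   [K]; the supporting hyperplane at [w0] then bounds [F (w0 + t v)] below. *)
Lemma hess_ge0 v : 0 <= dot (hess F w0 v) v.
Proof.
have [r r0 Hr] := chart_mem.
have Fw0 : F w0 = 0.
  by have [|_ /iffLR/(_ Kw0)] := Hr w0; rewrite ?subrr ?normr0.
have N0 : forall u, K u -> dot (grad F w0) (u - w0) <= 0.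
  move=> u Ku; apply: chart_support => //; last exact: boundary_mem.
  by apply/near_distP; exists r => // y /Hr[_ _ /iffLR].
rewrite -(pmulr_rge0 _ (_ : 0 < 2^-1))//; apply/ler_addgt0Pr => e e0.
have v0 : 0 < `|v| ^+ 2 + 1 by rewrite ltr_wpDl// exprn_ge0.
pose e1 := e / (`|v| ^+ 2 + 1); have e10 : 0 < e1 by exact: divr_gt0.
have [r1 r10 H1] := C2_taylor w0 C2F e10.
have r20 : 0 < r / 2 by rewrite divr_gt0.
have [r3 r30 H3] := (continuous_distP _ _).1 (@C1_continuous _ _ F C2F.1 w0) _ r20.
pose q := Num.min (r / 2) (Num.min r1 r3).
have q0 : 0 < q by rewrite !lt_min r20 r10.
have v10 : 0 < `|v| + 1 by rewrite ltr_wpDl.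
pose t := q / (`|v| + 1); have t0 : 0 < t by exact: divr_gt0.
have tv : `|w0 + t *: v - w0| < q.
  rewrite [w0 + _]addrC addrK normrZ gtr0_norm// /t mulrAC ltr_pdivrMr//.
  by rewrite ltr_pM2l// ltrDl.
move: (tv); rewrite !lt_min => /and3P[tvr tv1 tv3].
have {}H3 := H3 _ tv3; rewrite Fw0 subr0 in H3.
set z := F (w0 + t *: v) in H3.
have si : (grad F w0) ord0 i = - s := chart_grad w0 KF.
have s1 : `|s| = 1.
  by apply/eqP; rewrite -sqrp_eq1// expr2 -normrM ss normr1.
have Kz : K (w0 + t *: v + (s * z) *: delta_mx ord0 i).
  have [|_ bdP _] := Hr (w0 + t *: v + (s * z) *: delta_mx ord0 i).
    rewrite addrAC; apply: le_lt_trans (ler_normD _ _) _.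
    rewrite normrZ norm_delta_rV mulr1 normrM s1 mul1r.
    by rewrite [r in _ < r](splitr r) ltr_leD.
  apply/boundary_mem/bdP.
  by have [_ _ -> _] := KF; rewrite mulrA ss mul1r subrr.
have := N0 _ Kz.
rewrite (_ : _ - w0 = t *: v + (s * z) *: delta_mx ord0 i); last first.
  by rewrite -[w0 + _ + _]addrA [w0 + _]addrC addrK.
rewrite dotDr !dotZr dot_delta si mulrN [s * z * s]mulrAC ss mul1r => zge.
have x1 : `|w0 - w0| < r1 by rewrite subrr normr0.
have := H1 _ _ x1 tv1; rewrite -/z Fw0 subr0 hessZ dotZl !dotZr ler_norml.
move=> /andP[_ zle].
have t20 : 0 < t ^+ 2 by rewrite exprn_gt0.
rewrite -(pmulr_rge0 _ t20).
have : e1 * `|t *: v| ^+ 2 <= t ^+ 2 * e.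
  rewrite normrZ gtr0_norm// exprMn mulrCA ler_pM2l// /e1 mulrAC.
  by rewrite ler_pdivrMr// ler_pM2l// lerDl.
by move=> ?; nra.
Qed.

(** The Cauchy-Schwarz argument for a positive semidefinite symmetric form: the form at [v + t u],
    with [u] the image of [v], has no constant term, so its linear coefficient [2 |u|^2] must
    vanish. *)
Lemma hess_kernel v : dot (hess F w0 v) v = 0 -> hess F w0 v = 0.
Proof.
move=> Hv; apply: dot_self_eq0; set u := hess F w0 v.
have uu0 : 0 <= dot u u.
  by apply: le_trans (norm_sqr_le_dot u); rewrite exprn_ge0.
have B0 := hess_ge0 u; set B := dot (hess F w0 u) u in B0.
have H t : 0 <= 2 * t * dot u u + t ^+ 2 * B.
  have := hess_ge0 (v + t *: u).
  rewrite hessD hessZ dotDl !dotDr !dotZl !dotZr Hv -/u -/B.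
  by rewrite [dot (hess _ _ u) v]hess_sym// -/u; congr (_ <= _); ring.
have B10 : 0 < B + 1 by rewrite ltr_wpDl.
(* Near-minimizer in [t], with [B + 1] because [B] may be 0; the inequality becomes
   [c^2 (B + 2) <= 0]. *)
have := H (- (dot u u / (B + 1))).
set c := dot u u / _; have cB : dot u u = c * (B + 1) by rewrite /c divfK// gt_eqF.
rewrite cB => h; have : c ^+ 2 * (B + 2) <= 0 by nra.
rewrite pmulr_lle0 ?ltr_wpDl// => c2; have : c ^+ 2 == 0.
  by rewrite eq_le c2 sqr_ge0.
by rewrite sqrf_eq0 => /eqP ->; rewrite mul0r.
Qed.

(** The gradient does not vary to first order along [v], and normalization is Lipschitz on gradients
    of a chart, whose norm is at least 1. *)
Lemma unit_normal_stationary v : hess F w0 v = 0 ->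
  is_derive w0 v (unit_normal F) 0.
Proof.
move=> Hv; apply/is_derive_epsP => e e0.
have en1 y : 1 <= enorm (grad F y).
  rewrite -sqrtr1 ler_wsqrtr//; apply: le_trans (norm_sqr_le_dot _).
  rewrite exprn_ege1//; apply: le_trans (coord_le_norm _ i).
  rewrite (chart_grad y KF) normrN.
  by rewrite le_eqVlt eq_sym -sqrp_eq1// expr2 -normrM ss normr1 eqxx.
set b := grad F w0; pose C := 1 + n%:R * (2 * `|b| + 1) * `|b|.
have C0 : 0 < C by rewrite ltr_wpDr// !mulr_ge0// addr_ge0// mulr_ge0.
have v10 : 0 < `|v| + 1 by rewrite ltr_wpDl.
pose e1 := Num.min 1 (e / C / (`|v| + 1)).
have e10 : 0 < e1 by rewrite lt_min ltr01 !divr_gt0.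
have [r r0 Hr] := C2_grad_strict w0 C2F e10.
apply/near_distP; exists (Num.min 1 r / (`|v| + 1)) => [|h].
  by rewrite divr_gt0// lt_min ltr01.
rewrite subr0 ltr_pdivlMr// lt_min => /andP[h1 hr].
have hv : `|h *: v| <= `|h| * (`|v| + 1) by rewrite normrZ ler_wpM2l// lerDl.
have := Hr w0 (h *: v); rewrite subrr normr0 => /(_ r0).
rewrite [w0 + _ - w0]addrC addKr => /(_ (le_lt_trans hv hr)).
rewrite hessZ Hv scaler0 subr0 [w0 + _]addrC -/b => ab.
rewrite subr0 /unit_normal -/b.
apply: le_trans (normalize_dist (en1 _) (en1 _)) _.
set a := grad F _ in ab *.
have ab1 : `|a - b| <= 1.
  apply: le_trans ab _; apply: mulr_ile1 => //; first exact: ltW.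
    by rewrite ge_min lexx.
  exact/ltW/(le_lt_trans hv h1).
have aC : 1 + n%:R * (`|a| + `|b|) * `|b| <= C.
  rewrite lerD2l ler_wpM2r// ler_wpM2l//.
  by have := ler_normD (a - b) b; rewrite subrK; lra.
apply: (@le_trans _ _ (`|a - b| * C)); first by rewrite ler_wpM2l.
rewrite -ler_pdivlMr//; apply: le_trans ab _.
apply: (@le_trans _ _ (e / C / (`|v| + 1) * (`|h| * (`|v| + 1)))).
  by rewrite ler_pM// ?(ltW e10)// ge_min lexx orbT.
by rewrite le_eqVlt; apply/orP; left; apply/eqP; field; rewrite !gt_eqF.
Qed.

Hypothesis Kcurv : forall (x : 'rV[R]_n) (kappa : R),
  boundary K x -> principal_curvature K x kappa -> 0 < kappa.

(* A tangent direction on which the Hessian degenerates would be an eigenvector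
   of the Weingarten map with eigenvalue [0]. *)
Lemma hess_tangent_eq0 v :
  dot (grad F w0) v = 0 -> dot (hess F w0 v) v = 0 -> v = 0.
Proof.
move=> Nv /hess_kernel/unit_normal_stationary dn.
apply: contrapT => /eqP v0.
suff : (0 : R) < 0 by rewrite ltxx.
apply: (Kcurv Kw0); split=> //; have [r r0 Hr] := chart_mem.
exists (ball w0 r), F; split.
- exact: ball_open.
- exact: ballxx.
- split=> [|y]; first exact: C2_holder_class.
  rewrite -ball_normE /= distrC => /Hr[intP bdP _]; split=> //.
  apply/eqP => /(congr1 (fun p : 'rV[R]_n => p ord0 i)).
  rewrite (chart_grad y KF) mxE => /eqP; rewrite oppr_eq0 => /eqP s0.
  by move/eqP: ss; rewrite s0 mul0r eq_sym oner_eq0.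
exists v; split=> //; first by rewrite dotC dotZl Nv mulr0.
by rewrite scale0r; case: dn.
Qed.

(** Adding the squared normal component makes the form definite on the whole space: at a zero both
    terms vanish, so the vector is tangent and degenerate, hence 0. The constant is the minimum on
    the unit sphere of the sup norm, extended by homogeneity. *)
Lemma hess_coercive : exists2 c : R, 0 < c & forall d,
  c * `|d| ^+ 2 <= dot (hess F w0 d) d + dot (grad F w0) d ^+ 2.
Proof.
pose Q (d : 'rV[R]_n) := dot (hess F w0 d) d + dot (grad F w0) d ^+ 2.
pose S : set 'rV[R]_n := [set d | `|d| = 1].
have cdot (p : 'rV[R]_n) : continuous (dot p) by exact: (C1_continuous (C2_dot p).1).
have cH : continuous (fun d => \sum_(j < n)
    dot (grad (partial j F) w0) d * dot (delta_mx ord0 j) d).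
  have := @continuous_big R 'I_n +%R 0 xpredT (@add_continuous _) 'rV[R]_n
    (index_enum _) (fun j d => dot (grad (partial j F) w0) d *
                               dot (delta_mx ord0 j) d).
  apply => j _ x.
  exact: (continuousM (@cdot _ x) (@cdot _ x)).
have cQ : continuous Q.
  have -> : Q = fun d => (\sum_(j < n)
    dot (grad (partial j F) w0) d * dot (delta_mx ord0 j) d) +
    dot (grad F w0) d * dot (grad F w0) d.
    apply/funext => x; rewrite /Q expr2; congr (_ + _); apply: eq_bigr => j _.
    by rewrite mxE [dot (delta_mx _ _) _]dotC dot_delta.
  move=> d; apply: (@cvgD _ _ _ (nbhs d)); first exact: cH.
  exact: (continuousM (@cdot _ d) (@cdot _ d)).
have Sc : compact S.
  apply: bounded_closed_compact.
    by exists 1; split=> // M M1 d /= ->; exact: ltW.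
  exact: ((continuous_closedP _).1 (@norm_continuous R _) _ (@closed_eq R 1)).
have QZ t d : Q (t *: d) = t ^+ 2 * Q d.
  by rewrite /Q hessZ dotZl !dotZr; ring.
have [[d0 Sd0]|S0] := pselect (S !=set0); last first.
  (* An empty sphere leaves only [d = 0], for which any constant serves. *)
  exists 1 => // d; have [->|d0] := eqVneq d 0.
    by rewrite normr0 expr0n mulr0 dot0r -/(Q 0) dot0r expr0n addr0.
  exfalso; apply: S0; exists (`|d|^-1 *: d).
  by rewrite /S /= normrZ gtr0_norm ?invr_gt0 ?normr_gt0// mulVf// normr_eq0.
have [c cS Hc] := EVT_min_rV (ex_intro _ d0 Sd0) Sc (continuous_subspaceT cQ).
have Qge0 d : 0 <= Q d by rewrite addr_ge0 ?sqr_ge0 ?hess_ge0.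
exists (Q c) => [|d]; last first.
  have [->|d0'] := eqVneq d 0.
    by rewrite normr0 expr0n mulr0 -/(Q 0); exact: Qge0.
  have d'0 : 0 < `|d| by rewrite normr_gt0.
  rewrite -/(Q d) (_ : d = `|d| *: (`|d|^-1 *: d)); last first.
    by rewrite scalerA divff ?scale1r// gt_eqF.
  rewrite QZ mulrC normrZ normr_id normrZ.
  rewrite gtr0_norm ?invr_gt0// mulVf ?gt_eqF// mulr1.
  rewrite ler_wpM2l ?sqr_ge0//; apply: Hc; rewrite inE /S /=.
  by rewrite normrZ gtr0_norm ?invr_gt0// mulVf// gt_eqF.
rewrite lt_neqAle Qge0 andbT; apply/negP => /eqP/esym/eqP.
rewrite /Q paddr_eq0 ?sqr_ge0 ?hess_ge0// sqrf_eq0 => /andP[/eqP q1 /eqP q2].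
move: cS; rewrite inE /S /= (hess_tangent_eq0 q2 q1) normr0 => /eqP.
by rewrite eq_sym oner_eq0.
Qed.

End ChartConvex.

(** * Paraboloids enclosing and enclosed by the body *)

Section Supports.
Context {R : realType} {n : nat} (K : set 'rV[R]_n).

(* [p] is the gradient of the gauge at the boundary point [w]; the last two
   clauses are the uniform smoothness of the gauge at [w] and the uniform
   convexity of [K] at [w], with a common modulus [m]. *)
Definition supports (m : R) (w p : 'rV[R]_n) :=
  [/\ dot p w = 1, forall u, K u -> dot p u <= 1, `|p| <= m,
    forall h, gauge K (w + h) <= 1 + dot p h + m * `|h| ^+ 2 &
    forall u, K u -> `|w - u| ^+ 2 <= m * (1 - dot p u)].

Lemma supportsW m m' w p : m <= m' -> supports m w p -> supports m' w p.
Proof.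
move=> mm' [pw pK pm pU pL]; split=> //.
- exact: le_trans pm mm'.
- by move=> h; apply: le_trans (pU h) _; rewrite lerD2l ler_wpM2r ?exprn_ge0.
- move=> u Ku; apply: le_trans (pL u Ku) _; rewrite ler_wpM2r// subr_ge0.
  exact: pK.
Qed.

Context (r M : R).
Hypothesis body : convex_body K r M.
Let Kconvex := body_convex body.
Let r0 := body_inner_gt0 body.
Let Kball := body_inner body.
Let M0 := body_outer_gt0 body.
Let Kbound := body_outer body.

(* The last hypothesis says that [K] contains a piece of a paraboloid tangent to
   its boundary at [w]. *)
Lemma gauge_upper_paraboloid (P B d0 : R) : 0 <= P -> 0 <= B -> 0 < d0 ->
  exists2 m : R, 0 < m & forall (w p : 'rV[R]_n) (a : R),
    K w -> r / 2 <= a -> `|p| <= P -> dot p w = 1 ->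
    (forall d, `|d| < d0 -> a * dot p d + B * `|d| ^+ 2 <= 0 -> K (w + d)) ->
    forall h, gauge K (w + h) <= 1 + dot p h + m * `|h| ^+ 2.
Proof.
move=> P0 B0 d00; pose nP := n%:R * P.
have nP0 : 0 <= nP by rewrite mulr_ge0.
pose C := 2 * (1 + (nP + 1) * M).
have C0 : 0 < C by rewrite mulr_gt0// ltr_wpDr// mulr_ge0 ?addr_ge0// ltW.
(* [C] will bound [|d| / |h|]; [m] is chosen so that [(r / 3) m |h|^2] dominates [B C^2 |h|^2],
   where [r / 3] is [r / 2], the lower bound of [a], times [2 / 3], that of [1 / (1 + t)]. *)
pose m := 3 * B * C ^+ 2 / r + 1.
have m1 : 1 <= m.
  by rewrite lerDr divr_ge0 ?(ltW r0)// mulr_ge0 ?sqr_ge0// mulr_ge0.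
have m0 : 0 < m by apply: lt_le_trans m1.
pose q := Num.min ((2 * (nP + 1))^-1) (Num.min (m^-1) (d0 / (2 * C))).
have q0 : 0 < q.
  have nP1 : 0 < nP + 1 by rewrite ltr_wpDl.
  have C20 : 0 < 2 * C by rewrite mulr_gt0.
  by rewrite !lt_min !invr_gt0 m0 divr_gt0// mulr_gt0.
have rest0 : 0 <= (nP + 2 / r) / q.
  by rewrite divr_ge0 ?(ltW q0)// addr_ge0// divr_ge0// ltW.
exists (m + (nP + 2 / r) / q); first by rewrite ltr_wpDr.
move=> w p a Kw ra pP pw HK h.
have ph : `|dot p h| <= nP * `|h|.
  by apply: le_trans (dot_le _ _) _; rewrite mulrA ler_wpM2r// ler_wpM2l.
have h0 : 0 <= `|h| by [].
(* For [|h| > q], subadditivity gives a bound linear in [|h|], absorbed by [|h|^2 / q]. *)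
have [hq|hq] := leP `|h| q; last first.
  have gw1 : gauge K w <= 1 by apply: gauge_le => //; rewrite invr1 scale1r.
  have gh := gauge_le_norm body h.
  apply: le_trans (gaugeD body _ _) _.
  have X1 : (nP + 2 / r) * `|h| <= (nP + 2 / r) / q * `|h| ^+ 2.
    rewrite expr2 mulrA ler_wpM2r// mulrAC ler_pdivlMr// ler_wpM2l ?(ltW hq)//.
    by rewrite addr_ge0// divr_ge0// ltW.
  have X2 : 0 <= m * `|h| ^+ 2 by rewrite mulr_ge0 ?(ltW m0)// exprn_ge0.
  rewrite [X in X <= _]mulrDl in X1; move: ph; rewrite ler_norml => /andP[X3 _].
  by rewrite mulrDl; lra.
move: hq; rewrite !le_min => /and3P[hq1 hq2 hq3].
have {}hq1 : (nP + 1) * `|h| <= 1 / 2.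
  move: hq1; rewrite -[_^-1]div1r ler_pdivlMr ?mulr_gt0 ?ltr_wpDl//.
  by move=> ?; lra.
have {}hq2 : m * `|h| <= 1.
  by rewrite -ler_pdivlMl// mulr1.
have {}hq3 : 2 * (C * `|h|) <= d0.
  by rewrite mulrA mulrC -ler_pdivlMr// mulr_gt0.
pose t := dot p h + m * `|h| ^+ 2.
have ht : `|t| <= (nP + 1) * `|h|.
  apply: le_trans (ler_normD _ _) _; rewrite [(nP + 1) * _]mulrDl mul1r lerD//.
  rewrite ger0_norm ?mulr_ge0 ?exprn_ge0 ?(ltW m0)//.
  by rewrite expr2 mulrA ler_piMl.
have t12 : `|t| <= 1 / 2 by apply: le_trans ht hq1.
have t1 : 1 / 2 <= 1 + t by move: t12; rewrite ler_norml => /andP[? ?]; lra.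
have t10 : 0 < 1 + t by lra.
(* This makes [w + d] equal to [(w + h) / (1 + t)]; its membership in [K] is exactly the bound
   [1 + t] on the gauge. *)
pose d := (1 + t)^-1 *: (h - t *: w).
have dC : `|d| <= C * `|h|.
  rewrite normrZ gtr0_norm ?invr_gt0// ler_pdivrMl//.
  apply: le_trans (ler_normB _ _) _; rewrite normrZ.
  have : `|t| * `|w| <= (nP + 1) * `|h| * M by rewrite ler_pM// Kbound.
  have : 1 / 2 * (C * `|h|) <= (1 + t) * (C * `|h|).
    by rewrite ler_wpM2r// mulr_ge0// ltW.
  by rewrite /C; lra.
have [->|hn0] := eqVneq h 0.
  rewrite addr0 dot0r normr0 expr0n mulr0 !addr0.
  by apply: gauge_le => //; rewrite invr1 scale1r.
have hgt0 : 0 < `|h| by rewrite normr_gt0.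
have Kd : K (w + d).
  apply: HK.
    apply: le_lt_trans dC _; apply: lt_le_trans hq3.
    by rewrite mulr_natl mulr2n ltrDl mulr_gt0.
  rewrite /d dotZr dotBr dotZr pw mulr1 -/d.
  rewrite (_ : dot p h - t = - (m * `|h| ^+ 2)); last by rewrite /t; ring.
  have dC2 : `|d| ^+ 2 <= C ^+ 2 * `|h| ^+ 2.
    rewrite -exprMn lerXn2r ?nnegrE//.
    by rewrite mulr_ge0// ltW.
  have t32 : 1 + t <= 3 / 2.
    by move: t12; rewrite ler_norml => /andP[? ?]; lra.
  have it : 2 / 3 <= (1 + t)^-1 by rewrite -invf_div lef_pV2 ?posrE//; lra.
  have X0 : 0 <= m * `|h| ^+ 2 by rewrite mulr_ge0 ?(ltW m0)// exprn_ge0.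
  have H1 : r / 2 * (2 / 3 * (m * `|h| ^+ 2)) <=
            a * ((1 + t)^-1 * (m * `|h| ^+ 2)).
    apply: ler_pM => //; last exact: ler_wpM2r.
      by rewrite divr_ge0// ltW.
    by rewrite mulr_ge0.
  have H2 : B * `|d| ^+ 2 <= B * (C ^+ 2 * `|h| ^+ 2) by rewrite ler_wpM2l.
  have H3 : B * (C ^+ 2 * `|h| ^+ 2) <= r / 2 * (2 / 3 * (m * `|h| ^+ 2)).
    have -> : r / 2 * (2 / 3 * (m * `|h| ^+ 2)) =
        B * (C ^+ 2 * `|h| ^+ 2) + r / 3 * `|h| ^+ 2.
      by rewrite /m; field; rewrite gt_eqF.
    by rewrite lerDl mulr_ge0 ?exprn_ge0// divr_ge0// ltW.
  by rewrite !mulrN; lra.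
have : gauge K (w + h) <= 1 + t.
  apply: gauge_le => //; move: Kd.
  rewrite (_ : w + d = (1 + t)^-1 *: (w + h))//.
  by apply/rowP => j; rewrite !mxE; field; rewrite gt_eqF.
move/le_trans; apply; rewrite /t addrA lerD2l ler_wpM2r ?exprn_ge0//.
by rewrite lerDl.
Qed.

(** The local bound is tested at the point a fraction [t] of the way from [w] to [u]. The left side
    scales by [t^2], the right by [t], so it extends to all of [K] with constant [1 / (c t)]. *)
Lemma lower_paraboloid (c d0 : R) : 0 < c -> 0 < d0 ->
  exists2 m : R, 0 < m & forall w p : 'rV[R]_n,
    K w -> dot p w = 1 ->
    (forall y, K y -> `|y - w| < d0 -> c * `|y - w| ^+ 2 <= 1 - dot p y) ->
    forall u, K u -> `|w - u| ^+ 2 <= m * (1 - dot p u).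
Proof.
(* The diameter of [K] is at most [2 M], so the tested point is within [d0 / 2] of [w]. *)
move=> c0 d00; pose t := Num.min 1 (d0 / (4 * M)).
have t0 : 0 < t by rewrite lt_min ltr01 divr_gt0// mulr_gt0.
have t1 : t <= 1 by rewrite ge_min lexx.
have td : t * (4 * M) <= d0.
  by rewrite -ler_pdivlMr ?mulr_gt0// ge_min lexx orbT.
exists (c * t)^-1; first by rewrite invr_gt0 mulr_gt0.
move=> w p Kw pw H u Ku; rewrite ler_pdivlMl ?mulr_gt0//.
pose y := t *: u + (1 - t) *: w.
have yw : y - w = t *: (u - w).
  by apply/rowP => j; rewrite !mxE; ring.
have : c * `|y - w| ^+ 2 <= 1 - dot p y.
  apply: H; first by apply: Kconvex; rewrite ?(ltW t0).
  rewrite yw normrZ gtr0_norm//.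
  have uw : `|u - w| <= 2 * M.
    apply: le_trans (ler_normB _ _) _.
    by rewrite mulr_natl mulr2n lerD// Kbound.
  have : t * `|u - w| <= t * (2 * M) by rewrite ler_pM2l.
  have : 0 < t * M by rewrite mulr_gt0.
  by move=> ? ?; lra.
rewrite yw normrZ gtr0_norm// exprMn /y dotDr !dotZr pw distrC.
move=> h; rewrite -(ler_pM2l t0); move: h; rewrite mulr1.
by congr (_ <= _); ring.
Qed.

End Supports.

Lemma hess_bound {R : realType} {n : nat} (f : 'rV[R]_n -> R) x :
  exists2 B : R, 0 <= B & forall d, `|hess f x d| <= B * `|d|.
Proof.
pose S := \sum_(j < n) `|grad (partial j f) x|.
have S0 : 0 <= S by apply: sumr_ge0.
exists (n%:R * S) => [|d]; first by rewrite mulr_ge0.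
apply: norm_le_coord => [|j]; first by rewrite !mulr_ge0.
rewrite mxE; apply: le_trans (dot_le _ _) _.
rewrite mulrA ler_wpM2r// ler_wpM2l// /S (bigD1 j)//= lerDl.
exact: sumr_ge0.
Qed.

(** The arithmetic of uniform convexity. Here [x] is the length of a displacement [d], [b] its depth
    below the tangent plane at [w], [q] the Hessian form at [w0], [z - b] the component along the
    normal at [w0], and [f] the value of [F]. Coercivity bounds [c x^2] by [q + (z - b)^2]; Taylor
    and [f <= 0] bound [q] by [2 b] plus an error. *)
Lemma hess_descent {R : realFieldType} (b x q z c e f : R) :
  0 <= b -> b <= 1 / 2 -> `|z| <= e * x -> 0 <= e -> e <= 1 -> e <= c / 16 ->
  0 <= x -> c * x ^+ 2 <= q + (z - b) ^+ 2 ->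
  - (e * x ^+ 2) <= f - - b - q / 2 -> f <= 0 -> c / 8 * x ^+ 2 <= b.
Proof.
move=> b0 b1 zx e0 e1 ec x0 h1 h2 f0.
have bb : b ^+ 2 <= b / 2 by rewrite expr2 ler_wpM2l//; lra.
have exx : e * x ^+ 2 <= c / 16 * x ^+ 2 by rewrite ler_wpM2r ?exprn_ge0.
have zz : z ^+ 2 <= c / 16 * x ^+ 2.
  have : z ^+ 2 <= (e * x) ^+ 2.
    by rewrite -(real_normK (num_real z)) lerXn2r ?nnegrE ?mulr_ge0.
  move/le_trans; apply; apply: le_trans exx.
  by rewrite exprMn ler_wpM2r ?exprn_ge0// expr2 ler_piMl.
have zb : (z - b) ^+ 2 <= 2 * z ^+ 2 + 2 * b ^+ 2.
  by have := sqr_ge0 (z + b); lra.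
by lra.
Qed.

Section UniformSupports.
Context {R : realType} {n : nat} (K : set 'rV[R]_n) (r M : R).
Hypothesis body : convex_body K r M.
Hypothesis Kcurv : forall (x : 'rV[R]_n) (kappa : R),
  boundary K x -> principal_curvature K x kappa -> 0 < kappa.

(** At [w] near [w0] the normal [p] is the gradient [N] of the chart divided by [N.w]. Taylor for
    [F] puts a paraboloid inside [K]; coercivity of the Hessian at [w0], perturbed to [w], keeps [K]
    inside another. *)
Lemma chart_supports w0 F i s : chart K w0 F i s -> boundary K w0 ->
  exists m : R, \forall w \near w0,
    boundary K w -> exists p, supports K m w p.
Proof.
move=> KF Kw0; have [C2F ss _ _] := KF.
have r0 := body_inner_gt0 body; have M0 := body_outer_gt0 body.
have [rc rc0 Hc] := chart_mem body KF.
have [c c0 Hcoer] := hess_coercive body KF Kw0 Kcurv.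
have [B B0 HB] := hess_bound F w0.
set N0 := grad F w0 in Hcoer.
pose L := `|N0| + 1; have L0 : 0 < L by rewrite ltr_wpDl.
pose e := Num.min 1 (c / 16).
have e0 : 0 < e by rewrite lt_min ltr01 divr_gt0.
have e1 : e <= 1 by rewrite ge_min lexx.
have ec : e <= c / 16 by rewrite ge_min lexx orbT.
clearbody e.
have [rt rt0 Ht] := C2_taylor w0 C2F e0.
have [rg rg0 Hg] := C2_grad_strict w0 C2F (@ltr01 R).
have n10 : 0 < n%:R + 1 :> R by rewrite ltr_wpDl.
have B10 : 0 < 1 + B by rewrite ltr_wpDr.
(* The first three radii are those of the chart, Taylor and gradient estimates; the last two bound
   [n |N - N0|] by [e] and the depth [b] by [1 / 2], as [hess_descent] requires. *)
pose d0 := Num.min rc (Num.min rt (Num.min rg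
  (Num.min (e / ((n%:R + 1) * (1 + B))) (1 / (2 * ((n%:R + 1) * L)))))).
have d00 : 0 < d0.
  have nB0 : 0 < (n%:R + 1) * (1 + B) by rewrite mulr_gt0.
  have nL0 : 0 < 2 * ((n%:R + 1) * L) by rewrite mulr_gt0// mulr_gt0.
  by rewrite !lt_min rc0 rt0 rg0 !divr_gt0.
have [drc drt drg drB drL] : [/\ d0 <= rc, d0 <= rt, d0 <= rg,
    (n%:R + 1) * (1 + B) * d0 <= e & 2 * ((n%:R + 1) * L) * d0 <= 1].
  have : d0 <= d0 by []; rewrite {2}/d0 !le_min => /and5P[-> -> -> h1 h2].
  split=> //.
    by move: h1; rewrite ler_pdivlMr ?mulr_gt0// => h; rewrite mulrC.
  by move: h2; rewrite ler_pdivlMr ?mulr_gt0// => h; rewrite mulrC.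
clearbody d0.
have d20 : 0 < d0 / 2 by rewrite divr_gt0.
have dd : d0 / 2 < d0 by lra.
pose P := 2 / r * L; have P0 : 0 <= P by rewrite mulr_ge0 ?divr_ge0// ltW.
pose B1 := n%:R * B / 2 + e.
have B10' : 0 <= B1 by rewrite addr_ge0 ?(ltW e0)// divr_ge0// mulr_ge0.
have [m1 m10 Hm1] := gauge_upper_paraboloid body P0 B10' d20.
pose A := (n%:R + 1) * (L * M).
have A0 : 0 < A by rewrite mulr_gt0// mulr_gt0.
have cA0 : 0 < c / (16 * A) by rewrite divr_gt0// mulr_gt0.
have [m2 m20 Hm2] := lower_paraboloid body cA0 d20.
exists (P + m1 + m2); apply/near_distP; exists (d0 / 2) => // w ww0 Kw.
have wd0 : `|w - w0| < d0 by apply: lt_trans dd.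
have Kw' : K w by exact: boundary_mem body _ Kw.
have Fw : F w = 0.
  by have [|_ [+ _] _] := Hc w; [exact: lt_le_trans drc|exact].
set N := grad F w.
have NN0 : `|N - N0| <= (1 + B) * d0.
  have x0 : `|w0 - w0| < rg by rewrite subrr normr0.
  have := Hg w0 (w - w0) x0; rewrite [w0 + _]addrC subrK => /(_ _).
  move=> /(_ (lt_le_trans wd0 drg)); rewrite -/N -/N0 mul1r => h1.
  have h2 := HB (w - w0).
  have := ler_normD (N - N0 - hess F w0 (w - w0)) (hess F w0 (w - w0)).
  rewrite subrK => h3.
  have : (1 + B) * `|w - w0| <= (1 + B) * d0 by rewrite ler_pM2l// ltW.
  by lra.
have nB : n%:R * ((1 + B) * d0) <= e.
  have : 0 <= (1 + B) * d0 by rewrite mulr_ge0// ltW.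
  by lra.
have B1d : (1 + B) * d0 <= 1.
  have : 0 <= n%:R * ((1 + B) * d0) by rewrite !mulr_ge0// ltW.
  by lra.
have NL : `|N| <= L.
  by have := ler_normD (N - N0) N0; rewrite subrK /L; lra.
have s1 : `|s| = 1.
  by apply/eqP; rewrite -sqrp_eq1// expr2 -normrM ss normr1.
have N1 : 1 <= `|N|.
  by apply: le_trans (coord_le_norm _ i); rewrite (chart_grad w KF) normrN s1.
have N_gt0 : 0 < `|N| by apply: lt_le_trans N1.
have supp u : K u -> dot N (u - w) <= 0.
  move=> Ku; apply: (chart_support body KF) => //.
  apply/near_distP; exists (d0 / 2) => // y yw.
  have [|_ _ [+ _]] := Hc y; last exact.
  apply: lt_le_trans drc; rewrite -(subrKA w).
  by apply: le_lt_trans (ler_normD _ _) _; lra.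
pose a := dot N w.
(* The supporting inequality is tested at the point of the inner ball in the direction of [N]. *)
have ra : r / 2 <= a.
  have := supp ((r / 2 / `|N|) *: N).
  rewrite dotBr dotZr subr_le0 -/a => H.
  apply: (@le_trans _ _ (r / 2 / `|N| * dot N N)); last first.
    apply: H; apply: (body_inner body).
    rewrite normrZ gtr0_norm ?divr_gt0// divfK ?gt_eqF//; lra.
  rewrite -mulrA -[X in X <= _]mulr1 ler_wpM2l//; first by rewrite divr_ge0// ltW.
  rewrite ler_pdivlMl// mulr1; apply: le_trans (norm_sqr_le_dot _).
  by rewrite expr2 ler_peMr.
have a0 : 0 < a by apply: lt_le_trans ra; rewrite divr_gt0.
have aA : a <= A.
  apply: le_trans (ler_norm _) _; apply: le_trans (dot_le _ _) _.
  apply: ler_pM => //; first by rewrite lerDl.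
  by apply: ler_pM => //; exact: body_outer body _ Kw'.
pose p := a^-1 *: N.
have pw : dot p w = 1 by rewrite dotZl mulVf// gt_eqF.
have pK u : K u -> dot p u <= 1.
  move=> /supp; rewrite dotBr subr_le0 -/a => h.
  by rewrite dotZl ler_pdivrMl// mulr1.
have pP : `|p| <= P.
  rewrite normrZ gtr0_norm ?invr_gt0//; apply: ler_pM => //.
    by rewrite invr_ge0 ltW.
  by rewrite -[2 / r]invf_div lef_pV2 ?posrE// divr_gt0.
have aN u : a * dot p u = dot N u.
  by rewrite dotZl mulrA divff ?mul1r// gt_eqF.
have taylor d : `|d| < d0 / 2 ->
    `|F (w + d) - dot N d - dot (hess F w0 d) d / 2| <= e * `|d| ^+ 2.
  move=> dd2; have := Ht w d (lt_le_trans wd0 drt).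
  rewrite Fw subr0; apply; apply: lt_le_trans drt.
  by rewrite addrAC (le_lt_trans (ler_normD _ _))// [d0]splitr ltrD.
have wdc d : `|d| < d0 / 2 -> `|w + d - w0| < rc.
  move=> dd2; apply: lt_le_trans drc.
  by rewrite addrAC (le_lt_trans (ler_normD _ _))// [d0]splitr ltrD.
exists p; split=> //.
- by apply: le_trans pP _; rewrite -addrA lerDl addr_ge0// ltW.
- have H := Hm1 w p a Kw' ra pP pw.
  move=> h; apply: le_trans (H _ h) _; last first.
    rewrite lerD2l ler_wpM2r ?exprn_ge0//.
    by rewrite [P + m1]addrC -addrA lerDl addr_ge0// ltW.
  move=> d dd2; rewrite aN => hd.
  have [_ _ [_ toK]] := Hc _ (wdc d dd2); apply: toK.
  have := taylor d dd2; rewrite ler_norml => /andP[_ h2].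
  have h3 : dot (hess F w0 d) d <= n%:R * B * `|d| ^+ 2.
    apply: le_trans (ler_norm _) _; apply: le_trans (dot_le _ _) _.
    by rewrite -mulrA ler_wpM2l// expr2 mulrA ler_wpM2r.
  by move: hd; rewrite /B1 mulrDl; lra.
- have H := Hm2 w p Kw' pw.
  move=> u Ku; apply: le_trans (H _ _ Ku) _; last first.
    rewrite ler_wpM2r ?subr_ge0; [by []|exact: pK|].
    by rewrite lerDr addr_ge0// ltW.
  move=> y Ky; set d := y - w => dd2.
  have yE : y = w + d by rewrite /d addrC subrK.
  have ad : a * (1 - dot p y) = - dot N d.
    by rewrite mulrBr mulr1 aN /d dotBr -/a opprB.
  set b := - dot N d in ad; have Nd : dot N d = - b by rewrite /b opprK.
  have b0 : 0 <= b by rewrite oppr_ge0 supp.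
  have Fy : F (w + d) <= 0.
    by have [_ _ [toF _]] := Hc _ (wdc d dd2); apply: toF; rewrite -yE.
  have := taylor d dd2; rewrite ler_norml Nd => /andP[h1 _].
  have h2 := Hcoer d.
  set x := `|d| in dd2 h1 h2 *; have x0 : 0 <= x by exact: normr_ge0.
  set q := dot (hess F w0 d) d in h1 h2.
  have h3 : `|dot (N0 - N) d| <= e * x.
    apply: le_trans (dot_le _ _) _; rewrite mulrA ler_wpM2r//.
    by rewrite distrC; exact: le_trans (ler_wpM2l (ler0n _ _) NN0) nB.
  set z := dot (N0 - N) d in h3.
  have h4 : dot N0 d = z - b by rewrite /z dotBl Nd; ring.
  rewrite h4 in h2.
  have bL : b <= n%:R * (L * x).
    rewrite /b; apply: le_trans (ler_norm _) _; rewrite normrN.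
    apply: le_trans (dot_le _ _) _.
    by rewrite ler_wpM2l// ler_wpM2r.
  have b1 : b <= 1 / 2.
    apply: le_trans bL _.
    have : n%:R * (L * x) <= (n%:R + 1) * (L * d0).
      apply: ler_pM => //; first by rewrite mulr_ge0// ltW.
        by rewrite lerDl.
      by apply: ler_pM => //; rewrite ltW// (lt_trans dd2).
    move=> h; rewrite ler_pdivlMr// mulrC; apply: le_trans drL.
    by rewrite -!mulrA ler_pM2l.
  have cx := hess_descent b0 b1 h3 (ltW e0) e1 ec x0 h2 h1 Fy.
  rewrite -(ler_pM2l a0) ad; apply: le_trans cx.
  have -> : c / 8 * x ^+ 2 = 2 * A * (c / (16 * A) * x ^+ 2).
    by field; rewrite gt_eqF.
  apply: ler_wpM2r; first by rewrite mulr_ge0 ?exprn_ge0// ltW.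
  by lra.
Qed.

End UniformSupports.

(** * Quadratic bounds and differentiability *)

Lemma C2_quadratic {R : realType} {n : nat} (f : 'rV[R]_n -> R) x0 : C2 f ->
  exists C r : R, [/\ 0 <= C, 0 < r & forall y d,
    `|y - x0| < r -> `|y + d - x0| < r ->
    `|f (y + d) - f y - dot (grad f y) d| <= C * `|d| ^+ 2].
Proof.
move=> c2; have [B B0 HB] := hess_bound f x0.
have [r r0 Hr] := C2_taylor x0 c2 (@ltr01 R).
exists (n%:R * B / 2 + 1), r; split=> //.
  by rewrite addr_ge0// divr_ge0// mulr_ge0.
move=> y d yr ydr; have := Hr y d yr ydr.
have : `|dot (hess f x0 d) d| <= n%:R * B * `|d| ^+ 2.
  apply: le_trans (dot_le _ _) _.
  by rewrite -mulrA ler_wpM2l// expr2 mulrA ler_wpM2r.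
rewrite !ler_norml => /andP[? ?] /andP[? ?].
by apply/andP; split; lra.
Qed.

Lemma C2_grad_continuous {R : realType} {n : nat} (f : 'rV[R]_n -> R) x0 (e : R) :
  C2 f -> 0 < e -> exists2 r : R, 0 < r &
    forall y, `|y - x0| < r -> `|grad f y - grad f x0| <= e.
Proof.
move=> c2 e0; have [B B0 HB] := hess_bound f x0.
have [r r0 Hr] := C2_grad_strict x0 c2 (@ltr01 R).
have B10 : 0 < 1 + B by rewrite ltr_wpDr.
exists (Num.min r (e / (1 + B))); first by rewrite lt_min r0 divr_gt0.
move=> y; rewrite lt_min ltr_pdivlMr// => /andP[yr ye].
have := Hr x0 (y - x0); rewrite subrr normr0 [x0 + _]addrC subrK mul1r.
move=> /(_ r0 yr) h1; have h2 := HB (y - x0).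
have := ler_normD (grad f y - grad f x0 - hess f x0 (y - x0))
  (hess f x0 (y - x0)).
by rewrite subrK; lra.
Qed.

(** A one-sided quadratic bound suffices once the derivative exists: testing it at [h] and at [-h]
    gives the two inequalities. *)
Lemma derive_of_upper {R : realType} {V : normedModType R} (f : V -> R) x v
    (a C : R) : derivable f x v ->
  (forall h, f (x + h *: v) <= f x + h * a + C * h ^+ 2) -> 'D_v f x = a.
Proof.
move=> /derivableP/is_derive_epsP; set l := 'D_v f x => H fu.
have bound e : 0 < e -> `|l - a| <= e + `|C| * e.
  move=> e0; have /near_distP[r r0 Hr] := H e e0.
  pose h := Num.min e (r / 2).
  have h0 : 0 < h by rewrite lt_min e0 divr_gt0.
  have he : h <= e by rewrite ge_min lexx.
  have hr : h < r.
    apply: (@le_lt_trans _ _ (r / 2)); first by rewrite ge_min lexx orbT.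
    by rewrite ltr_pdivrMr// mulr_natr mulr2n ltrDl.
  have CC : C * h ^+ 2 <= `|C| * e * h.
    rewrite expr2 mulrA ler_pM2r//; apply: (@le_trans _ _ (`|C| * h)).
      by rewrite ler_pM2r// ler_norm.
    by rewrite ler_wpM2l.
  have := Hr h; have := Hr (- h).
  rewrite !subr0 normrN gtr0_norm// => /(_ hr) A1 /(_ hr) A2.
  have B1 := fu h; have B2 := fu (- h).
  move: A1 A2; rewrite [- h *: v + x]addrC [h *: v + x]addrC.
  have E1 : - h *: l = - (h * l) by rewrite scaleNr.
  have E2 : h *: l = h * l by [].
  rewrite E1 E2.
  rewrite sqrrN in B2; rewrite !ler_norml => /andP[A1 _] /andP[A2 _].
  have C1 : h * (l - a) <= h * (e + `|C| * e) by lra.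
  have C2 : h * (a - l) <= h * (e + `|C| * e) by lra.
  move: C1 C2; rewrite !ler_pM2l// => C1 C2.
  by apply/andP; split; lra.
apply/eqP; rewrite -subr_eq0 -normr_le0; apply/ler_addgt0Pr => e e0.
have C0 : 0 < 1 + `|C| by rewrite ltr_wpDr.
rewrite add0r [X in _ <= X](_ : _ = e / (1 + `|C|) + `|C| * (e / (1 + `|C|))).
  by apply: bound; rewrite divr_gt0.
by field; rewrite gt_eqF.
Qed.

(** The expansions hold for every increment [h], even one that leaves [V], so the gradients at any
    two points of [V] are comparable without convexity of [V]. *)
Lemma C11_of_paraboloids {R : realType} {n : nat} (f : 'rV[R]_n -> R)
    (V : set 'rV[R]_n) (C : R) : open V ->
  (forall x, V x -> exists p, forall h,
     `|f (x + h) - f x - dot p h| <= C * `|h| ^+ 2) ->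
  holder_class 1 1 V f.
Proof.
move=> oV H.
have [P HP] : exists P : 'rV[R]_n -> 'rV[R]_n, forall x, V x -> forall h,
    `|f (x + h) - f x - dot (P x) h| <= C * `|h| ^+ 2.
  have /choice[P HP] x : exists p, V x -> forall h,
      `|f (x + h) - f x - dot p h| <= C * `|h| ^+ 2.
    have [/H[p Hp]|nV] := pselect (V x); first by exists p.
    by exists 0.
  by exists P.
have [C' C'0 HP'] : exists2 C' : R, 0 < C' & forall x, V x -> forall h,
    `|f (x + h) - f x - dot (P x) h| <= C' * `|h| ^+ 2.
  exists (`|C| + 1) => [|x Vx h]; first by rewrite ltr_wpDl.
  apply: le_trans (HP x Vx h) _; rewrite ler_wpM2r ?exprn_ge0//.
  by apply: le_trans (ler_norm _) _; rewrite lerDl.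
have dP x i : V x -> is_derive x (delta_mx ord0 i : 'rV[R]_n) f (P x ord0 i).
  move=> Vx; apply/is_derive_epsP => e e0; apply/near_distP.
  exists (e / C') => [|h]; first exact: divr_gt0.
  rewrite subr0 ltr_pdivlMr// => /ltW he.
  have := HP' x Vx (h *: delta_mx ord0 i).
  rewrite dotZr dot_delta [x + _]addrC normrZ norm_delta_rV mulr1.
  move/le_trans; apply; rewrite expr2 mulrA ler_wpM2r//.
  by rewrite mulrC.
have pE x i : V x -> partial i f x = P x ord0 i.
  by move=> /(dP x i)[].
have lipP x y i : V x -> V y ->
    `|P y ord0 i - P x ord0 i| <= 6 * C' * `|y - x|.
  move=> Vx Vy; have [->|xy] := eqVneq y x.
    by rewrite !subrr !normr0 mulr0.
  set d := y - x; set a := `|d|.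
  have a0 : 0 < a by rewrite normr_gt0 subr_eq0.
  (* [f (y + k)] is expanded from [y] with increment [k] and from [x] with [d + k], and [f y] from
     [x] with [d]. The errors [a^2], [4 a^2] and [a^2] add up to the factor 6. *)
  pose k : 'rV[R]_n := a *: delta_mx ord0 i.
  have ka : `|k| = a by rewrite normrZ norm_delta_rV mulr1 gtr0_norm.
  have yE : y = x + d by rewrite /d addrC subrK.
  have A1 := HP' y Vy k; have A2 := HP' x Vx d; have A3 := HP' x Vx (d + k).
  rewrite addrA -yE in A3; rewrite -yE in A2.
  rewrite ka in A1; rewrite -/a in A2.
  have dk : `|d + k| ^+ 2 <= 4 * a ^+ 2.
    have : `|d + k| <= 2 * a.
      by apply: le_trans (ler_normD _ _) _; rewrite ka -/a; lra.
    move=> h; have := normr_ge0 (d + k); nra.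
  have {}A3 : `|f (y + k) - f x - dot (P x) (d + k)| <= C' * (4 * a ^+ 2).
    by apply: le_trans A3 _; rewrite ler_pM2l.
  move: A1 A2 A3; rewrite dotDr !dotZr !dot_delta !ler_norml.
  move=> /andP[? ?] /andP[? ?] /andP[? ?].
  by apply/andP; split; rewrite -(ler_pM2l a0); lra.
have nV x : V x -> exists2 r : R, 0 < r & forall y, `|y - x| < r -> V y.
  by move=> Vx; apply/near_distP; exact: open_nbhs_nbhs.
split=> [x Vx|i].
  apply/continuous_distP => e e0.
  pose M := C' + n%:R * `|P x|.
  have M0 : 0 < M by rewrite ltr_wpDr// mulr_ge0.
  exists (Num.min 1 (e / M)) => [|y]; first by rewrite lt_min ltr01 divr_gt0.
  rewrite lt_min ltr_pdivlMr// => /andP[y1 ye].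
  have := HP' x Vx (y - x); rewrite [x + _]addrC subrK => h1.
  have := dot_le (P x) (y - x) => h2.
  rewrite -(subrK (dot (P x) (y - x)) (f y - f x)).
  apply: le_trans (ler_normD _ _) _; apply: le_trans (lerD h1 h2) _.
  apply: le_trans (ltW ye); rewrite /M mulrDr [`|y - x| * C']mulrC.
  apply: lerD; last by rewrite mulrA mulrC.
  by rewrite ler_pM2l// expr2 ler_piMl// ltW.
split=> [x Vx|]; first by case: (dP x i Vx).
split=> [x Vx|x Vx].
  apply/continuous_distP => e e0; have [r r0 Hr] := nV x Vx.
  have C60 : 0 < 6 * C' by rewrite mulr_gt0.
  exists (Num.min r (e / (6 * C'))) => [|y]; first by rewrite lt_min r0 divr_gt0.
  rewrite lt_min ltr_pdivlMr// mulrC => /andP[/Hr Vy /ltW ye].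
  by rewrite !pE//; apply: le_trans ye; exact: lipP.
exists 1 => //; exists (6 * C') => y z Vy Vz _ _.
by rewrite powRr1// !pE//; exact: lipP.
Qed.

(** * Constants uniform over the boundary *)

Lemma boundary_closed {T : topologicalType} (A : set T) : closed (boundary A).
Proof.
rewrite /boundary setDE; apply: closedI; first exact: closed_closure.
exact/open_closedC/open_interior.
Qed.

Lemma convex_bodyP {R : realType} {n : nat} (K : set 'rV[R]_n) :
  compact K -> convex_set (K : set (convex_lmodType 'rV[R]_n)) ->
  interior K 0 -> exists r M, convex_body K r M.
Proof.
move=> cK vK /near_distP[r r0 Hr].
have [M M0 HM] := bounded_setP (compact_bounded cK).
exists r, M; split=> //.
- exact: compact_closed.
- by move=> x y t; exact: convex_setP.
- by move=> x xr; apply: Hr; rewrite subr0.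
Qed.

(** The clauses of [supports] made homogeneous: the second order bound at distance [t] has constant
    [m / t], and the convexity clause is multiplied by [(g u)^2]. *)
Definition gauge_normal {R : realType} {n : nat} (g : 'rV[R]_n -> R) (m : R)
    (w p : 'rV[R]_n) :=
  [/\ dot p w = 1, forall u, dot p u <= g u, `|p| <= m,
    forall t h, 0 < t -> g (t *: w + h) <= t + dot p h + m / t * `|h| ^+ 2 &
    forall u, `|g u *: w - u| ^+ 2 <= m * (g u * (g u - dot p u))].

Record smooth_gauge {R : realType} {n : nat} (g : 'rV[R]_n -> R) (m : R) : Prop :=
  SmoothGauge {
    sg_gt0 : 0 < m;
    sg_ge0 : forall x, 0 <= g x;
    sgZ : forall x t, 0 <= t -> g (t *: x) = t * g x;
    sgD : forall x y, g (x + y) <= g x + g y;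
    sg_le_norm : forall x, g x <= m * `|x|;
    norm_le_sg : forall x, `|x| <= m * g x;
    sg_normal : forall w, g w = 1 -> exists p, gauge_normal g m w p }.

Section UniformSupport.
Context {R : realType} {n k : nat} (alpha : R) (K : set 'rV[R]_n).
Hypothesis k_ge2 : (2 <= k)%N.
Hypothesis K_compact : compact K.
Hypothesis K_convex : convex_set (K : set (convex_lmodType 'rV[R]_n)).
Hypothesis K_int0 : interior K 0.
Hypothesis K_boundary : holder_boundary k alpha K.
Hypothesis K_curv : forall (x : 'rV[R]_n) (kappa : R),
  boundary K x -> principal_curvature K x kappa -> 0 < kappa.

(** [supports] is monotone in [m], so each local constant works for all larger ones; compactness of
    the boundary, with the filter of large [m], yields a common one. *)
Lemma uniform_supports :
  exists m : R, forall w, boundary K w -> exists p, supports K m w p.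
Proof.
have [r [M body]] := convex_bodyP K_compact K_convex K_int0.
have : compact (boundary K).
  apply: (subclosed_compact (@boundary_closed _ K) K_compact) => x.
  exact: boundary_mem body _.
move=> /compact_near_coveringP/(_ _ (pinfty_nbhs R)
  (fun m w => boundary K w -> exists p, supports K m w p)) H.
have {}H : \forall m \near +oo,
    boundary K `<=` (fun w => boundary K w -> exists p, supports K m w p).
  apply: H => w Kw.
  have [F [i [s KF]]] := holder_boundary_chart k_ge2 K_boundary Kw.
  have [m Hm] := chart_supports body K_curv KF Kw.
  exists ([set y | boundary K y -> exists p, supports K m y p],
    [set m' | m <= m']).
    by split=> //; exact: nbhs_pinfty_ge (num_real m).
  move=> [y m'] /= [Hy mm'] /Hy[p Hp]; exists p; exact: supportsW Hp.
near (+oo : set_system R) => m; exists m => w Kw.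
have : boundary K `<=` (fun w => boundary K w -> exists p, supports K m w p).
  by near: m.
by move=> /(_ w Kw Kw).
Unshelve. all: by end_near. Qed.

Lemma gauge_smooth : exists m, smooth_gauge (gauge K) m.
Proof.
have [r [M body]] := convex_bodyP K_compact K_convex K_int0.
have [m1 Hm1] := uniform_supports.
have r0 := body_inner_gt0 body; have M0 := body_outer_gt0 body.
pose m := `|m1| + M + 2 / r.
have r20 : 0 < 2 / r by rewrite divr_gt0.
have m0 : 0 < m by rewrite ltr_wpDl// addr_ge0// ltW.
exists m; split=> //.
- by move=> x; exact: gauge_ge0 body x.
- by move=> x t t0; rewrite (gaugeZ body).
- exact: gaugeD body.
- move=> x; apply: le_trans (gauge_le_norm body x) _.
  by rewrite ler_wpM2r// lerDr addr_ge0// ltW.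
- move=> x; apply: le_trans (norm_le_gauge body x) _.
  rewrite ler_wpM2r//; first exact: gauge_ge0 body x.
  by rewrite /m -addrA addrCA lerDl addr_ge0// ltW.
move=> w w1.
have mm : m1 <= m.
  by apply: le_trans (ler_norm _) _; rewrite /m -addrA lerDl addr_ge0// ltW.
have [p /(supportsW mm) [pw pK pm pU pL]] := Hm1 w (gauge1_boundary body w1).
exists p; split=> //.
- by move=> u; have := dot_le_gauge body u ler01 pK; rewrite mul1r.
- move=> t h t0.
  rewrite (_ : t *: w + h = t *: (w + t^-1 *: h)); last first.
    by rewrite scalerDr scalerA divff ?gt_eqF// scale1r.
  rewrite (gaugeZ body) ?(ltW t0)//.
  apply: le_trans (ler_wpM2l (ltW t0) (pU _)) _.
  rewrite dotZr normrZ gtr0_norm ?invr_gt0//.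
  by rewrite le_eqVlt; apply/orP; left; apply/eqP; field; rewrite gt_eqF.
- move=> u; have [->|u0] := eqVneq u 0.
    by rewrite (gauge0 body) scale0r subrr normr0 expr0n mul0r mulr0.
  have gu := gauge_gt0 body u0.
  have Ku : K ((gauge K u)^-1 *: u).
    apply: (gauge_le1_mem body).
    by rewrite (gaugeZ body) ?invr_ge0 ?(ltW gu)// mulVf// gt_eqF.
  have := pL _ Ku; rewrite dotZr.
  have -> : gauge K u *: w - u = gauge K u *: (w - (gauge K u)^-1 *: u).
    by rewrite scalerBr scalerA divff ?gt_eqF// scale1r.
  rewrite normrZ gtr0_norm// exprMn => h.
  have -> : m * (gauge K u * (gauge K u - dot p u)) =
     gauge K u ^+ 2 * (m * (1 - (gauge K u)^-1 * dot p u)).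
    by field; rewrite gt_eqF.
  by rewrite ler_wpM2l// sqr_ge0.
Qed.

End UniformSupport.

(** * The obstacle *)

Section SmoothGauge.
Context {R : realType} {n : nat} (g : 'rV[R]_n -> R) (m : R).
Hypothesis sg : smooth_gauge g m.

Lemma sg0 : g 0 = 0.
Proof. by rewrite -(scale0r (0 : 'rV[R]_n)) (sgZ sg)// mul0r. Qed.

Lemma sg_pos x : x != 0 -> 0 < g x.
Proof.
move=> x0; rewrite -(pmulr_rgt0 _ (sg_gt0 sg)).
by apply: lt_le_trans (norm_le_sg sg x); rewrite normr_gt0.
Qed.

Lemma sg_unit x : x != 0 -> exists2 w, g w = 1 & x = g x *: w.
Proof.
move=> x0; have gx := sg_pos x0; exists ((g x)^-1 *: x).
  by rewrite (sgZ sg) ?invr_ge0 ?(ltW gx)// mulVf// gt_eqF.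
by rewrite scalerA divff ?scale1r// gt_eqF.
Qed.

Lemma sg_lip x y : g x - g y <= m * `|x - y|.
Proof.
apply: le_trans (sg_le_norm sg _); rewrite lerBlDr.
by apply: le_trans (sgD sg _ _); rewrite subrK.
Qed.

Lemma lip_continuous (f : 'rV[R]_n -> R) :
  (forall x y, f x - f y <= m * `|x - y|) -> continuous f.
Proof.
move=> fl x; apply/continuous_distP => e e0; have m0 := sg_gt0 sg.
exists (e / m) => [|y]; first exact: divr_gt0.
rewrite ltr_pdivlMr// mulrC => /ltW yx; apply: le_trans yx.
by rewrite ler_norml lerNl opprB fl distrC fl.
Qed.

(** Strict convexity: with no gap between [p.u] and [g u], the convexity clause of [gauge_normal]
    leaves no room off the ray of [w]. *)
Lemma sg_additive_eq w p u : gauge_normal g m w p -> dot p u = g u ->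
  u = g u *: w.
Proof.
move=> [_ _ _ _ pL] pu; have := pL u; rewrite pu subrr !mulr0 => h.
apply/esym/eqP; rewrite -subr_eq0 -normr_eq0 -sqrf_eq0 eq_le h.
by rewrite exprn_ge0.
Qed.

Lemma ler_norm_near (a b : 'rV[R]_n) (c : R) :
  `|a - b| <= c -> `|a| <= `|b| + c.
Proof.
move=> h; rewrite -{1}(subrK b a) addrC.
by apply: le_trans (ler_normD _ _) _; rewrite lerD2l.
Qed.

(* A displacement [d] almost tangent to the hypersurface with normal [N] cannot
   follow a ray [w] transversal to it, so uniform convexity makes the cost grow
   by at least a multiple of [|d|^2 / g u]; for small [g u] this beats all
   quadratic error terms. *)
Lemma transversal_eq0 w p N d u (t L be CF C eta : R) :
  gauge_normal g m w p -> g w = 1 -> u = t *: w - d -> `|N| <= L ->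
  0 < be -> be <= `|dot N w| -> 0 <= CF -> `|dot N d| <= CF * `|d| ^+ 2 ->
  0 <= C -> g u - dot p u <= C * `|d| ^+ 2 ->
  g u <= m * (2 * eta) -> `|d| <= 2 * eta ->
  eta * (4 * (m * CF / be + 1)) <= 1 ->
  eta * (2 * m * (m * (C + 1) * (2 * (1 + m * (n%:R * L / be))) ^+ 2)) <= 1 ->
  d = 0.
Proof.
move=> [_ pg _ _ pL] w1 uE NL be0 Nw CF0 Nd C0 gap small deta eta1 eta2.
have m0 := sg_gt0 sg; pose C4 := 2 * (1 + m * (n%:R * L / be)).
rewrite -/C4 in eta2.
have gu0 : 0 <= g u := sg_ge0 sg u.
(* [e] measures how far [u] is off the ray of [w]; convexity bounds it by the gap. *)
pose e := g u *: w - u.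
have eE : e = (g u - t) *: w + d.
  by rewrite /e; apply/rowP => j; rewrite [in RHS]mxE uE !mxE; ring.
have wm : `|w| <= m by have := norm_le_sg sg w; rewrite w1 mulr1.
have e2 : `|e| ^+ 2 <= m * (m * (2 * eta) * (C * `|d| ^+ 2)).
  apply: le_trans (pL u) _; rewrite ler_pM2l//.
  by apply: ler_pM => //; rewrite subr_ge0.
(* Pairing [e] with [N] isolates the component along [w], since [N.d] is quadratic in [d] and [N.w]
   is bounded away from 0. *)
have c1be : `|g u - t| * be <= n%:R * L * `|e| + CF * `|d| ^+ 2.
  apply: (@le_trans _ _ (`|g u - t| * `|dot N w|)); first by rewrite ler_wpM2l.
  have dNe : (g u - t) * dot N w = dot N e - dot N d.
    by rewrite eE dotDr dotZr addrK.
  rewrite -normrM dNe.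
  apply: le_trans (ler_normB _ _) _; rewrite lerD//.
  by apply: le_trans (dot_le _ _) _; rewrite mulrA ler_wpM2r// ler_wpM2l.
have dC4 : `|d| <= C4 * `|e|.
  have h1 : `|d| <= `|e| + `|g u - t| * m.
    have -> : d = e - (g u - t) *: w by rewrite eE addrC addKr.
    by apply: le_trans (ler_normB _ _) _; rewrite lerD2l normrZ ler_wpM2l.
  have h2 : `|g u - t| <= n%:R * L / be * `|e| + CF / be * `|d| ^+ 2.
    rewrite -(ler_pM2r be0); apply: le_trans c1be _.
    rewrite le_eqVlt; apply/orP; left; apply/eqP.
    by field; rewrite gt_eqF.
  have h3 : m * CF / be * `|d| * `|d| <= `|d| / 2.
    have k0 : 0 <= m * CF / be.
      by rewrite divr_ge0 ?(ltW be0)// mulr_ge0// ltW.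
    have k1 : m * CF / be * `|d| <= m * CF / be * (2 * eta) by rewrite ler_wpM2l.
    have k2 : 0 <= eta by have := le_trans (normr_ge0 d) deta; lra.
    rewrite [X in _ <= X]mulrC ler_wpM2r//; apply: le_trans k1 _.
    by move: eta1 k2; move: (m * CF / be) => X; lra.
  have h4 : `|g u - t| * m <= (n%:R * L / be * `|e| + CF / be * `|d| ^+ 2) * m.
    by rewrite ler_pM2r.
  move: h1 h3 h4; rewrite /C4; move: (n%:R * L / be) (`|e|) (`|d|) => X Y Z.
  by move: (`|_| * m) => T; lra.
apply/eqP; rewrite -normr_eq0; apply: contraT => d0.
have C40 : 0 < C4.
  have L0 : 0 <= L := le_trans (normr_ge0 _) NL.
  by rewrite /C4 mulr_gt0// ltr_wpDr// mulr_ge0 ?(ltW m0)//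
    divr_ge0 ?(ltW be0)// mulr_ge0.
have e0 : 0 < `|e|.
  by rewrite -(pmulr_rgt0 _ C40); apply: lt_le_trans dC4; rewrite lt0r d0 /=.
have d2 : `|d| ^+ 2 <= C4 ^+ 2 * `|e| ^+ 2.
  by rewrite -exprMn lerXn2r ?nnegrE// mulr_ge0// ltW.
have eta0 : 0 < eta.
  have : 0 < `|d| by rewrite lt0r d0 /=.
  by move=> /lt_le_trans/(_ deta); rewrite pmulr_rgt0.
have h1 : m * (m * (2 * eta) * (C * `|d| ^+ 2)) <=
    m * (m * (2 * eta)) * (C * (C4 ^+ 2 * `|e| ^+ 2)).
  rewrite mulrA ler_wpM2l//; last by rewrite ler_wpM2l.
  by do 3 (apply: mulr_ge0; [exact: ltW|]) => //; exact: ltW.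
have ee0 : 0 < `|e| ^+ 2 by rewrite exprn_gt0.
have h2 : 0 < m * (m * (2 * eta)) * (C4 ^+ 2 * `|e| ^+ 2).
  apply: mulr_gt0; last by apply: mulr_gt0 => //; exact: exprn_gt0.
  by apply: mulr_gt0 => //; apply: mulr_gt0 => //; apply: mulr_gt0.
(* With [C + 1] in place of [C] the contraction factor is strictly below 1, which contradicts
   [0 < |e|]. *)
have h3 : eta * (2 * m * (m * (C + 1) * C4 ^+ 2)) * `|e| ^+ 2 <= `|e| ^+ 2.
  by rewrite ger_pMl.
move: e2 h1 h2 h3; move: (C4 ^+ 2) (`|e| ^+ 2) (`|d| ^+ 2) => X Y Z.
by move=> *; exfalso; lra.
Qed.

End SmoothGauge.

Section Rho.
Context {R : realType} {n : nat} (K U : set 'rV[R]_n) (phi : 'rV[R]_n -> R).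
Context (m : R).
Implicit Types (x y z w p h : 'rV[R]_n) (s t e d : R).
Hypothesis sg : smooth_gauge (gauge K) m.
Hypothesis bd_compact : compact (boundary U).
Hypothesis bd_nonempty : boundary U !=set0.
Hypothesis phi_cont : continuous phi.
Hypothesis phi_strict : forall x y, x != y -> phi x - phi y < gauge K (x - y).
Local Notation g := (gauge K).
Local Notation rho := (rho K U phi).
Local Notation rho_closest := (rho_closest K U phi).
Let m0 := sg_gt0 sg.

Let cost_continuous x : continuous (fun z : 'rV[R]_n => g (x - z) + phi z).
Proof.
move=> z; apply: (@cvgD _ _ _ (nbhs z)); last exact: phi_cont.
apply/(lip_continuous sg (f := fun z => g (x - z))) => a b.
apply: le_trans (sg_lip sg _ _) _.
by rewrite opprB addrC addrA subrK distrC.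
Qed.

Lemma rho_closest_le x z : rho_closest x z ->
  forall z', boundary U z' -> g (x - z) + phi z <= g (x - z') + phi z'.
Proof.
move=> [Uz <-] z' Uz'; apply: ge_inf; last by exists z'.
have [c _ Hc] := EVT_min_rV bd_nonempty bd_compact
  (continuous_subspaceT (@cost_continuous x)).
by exists (g (x - c) + phi c) => _ [y Uy <-]; apply: Hc; rewrite inE.
Qed.

Lemma closest_of_min x z : boundary U z ->
  (forall z', boundary U z' -> g (x - z) + phi z <= g (x - z') + phi z') ->
  rho_closest x z.
Proof.
move=> Uz H; split=> //; apply/le_anti/andP; split.
  apply: ge_inf; last by exists z.
  by exists (g (x - z) + phi z) => _ [y Uy <-]; exact: H.
apply: lb_le_inf; first by exists (g (x - z) + phi z); exists z.
by move=> _ [y Uy <-]; exact: H.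
Qed.

Lemma rho_attained x : exists z, rho_closest x z.
Proof.
have [c cU Hc] := EVT_min_rV bd_nonempty bd_compact
  (continuous_subspaceT (@cost_continuous x)).
rewrite inE in cU; exists c; apply: closest_of_min => // z' Uz'.
by apply: Hc; rewrite inE.
Qed.

Lemma rho_le x z : boundary U z -> rho x <= g (x - z) + phi z.
Proof.
have [z0 cz0] := rho_attained x => Uz.
by case: (cz0) => _ ->; exact: rho_closest_le.
Qed.

(** A closest point of [y] competes for [x]. The gauge need not be even, so the order in [x - y]
    matters. *)
Lemma rho_sub_le x y : rho x <= rho y + g (x - y).
Proof.
have [z [Uz ->]] := rho_attained y; apply: le_trans (rho_le x Uz) _.
rewrite addrAC lerD2r -[x - z](subrKA y) addrC; exact: sgD sg _ _.
Qed.

Lemma rho_continuous : continuous rho.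
Proof.
apply: (lip_continuous sg) => x y; rewrite lerBlDl.
by apply: le_trans (rho_sub_le x y) _; rewrite lerD2l sg_le_norm.
Qed.

Lemma rho_upper x z t w p h : rho_closest x z -> 0 < t -> x - z = t *: w ->
  g w = 1 -> gauge_normal g m w p ->
  rho (x + h) <= rho x + dot p h + m / t * `|h| ^+ 2.
Proof.
move=> [Uz ->] t0 xz w1 [_ _ _ pU _]; apply: le_trans (rho_le _ Uz) _.
rewrite [x + h - z]addrAC xz (sgZ sg) ?(ltW t0)// w1 mulr1.
have := pU t h t0; lra.
Qed.

(** Equal costs on one ray would make [phi z1 - phi z2] equal to [t2 - t1 = g (z1 - z2)], which
    strictness of [phi] excludes for distinct points. *)
Lemma closest_same_direction x z1 z2 w t1 t2 :
  rho_closest x z1 -> rho_closest x z2 -> g w = 1 -> 0 <= t1 -> 0 <= t2 ->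
  x - z1 = t1 *: w -> x - z2 = t2 *: w -> z1 = z2.
Proof.
wlog t12 : z1 z2 t1 t2 / t1 <= t2.
  move=> H c1 c2 w1 t10 t20 e1 e2; have [t12|/ltW t12] := leP t1 t2.
    exact: H c1 c2 w1 t10 t20 e1 e2.
  by apply/esym; exact: H c2 c1 w1 t20 t10 e2 e1.
move=> [_ c1] [_ c2] w1 t10 t20 e1 e2; apply: contrapT => /eqP /phi_strict.
have -> : z1 - z2 = (t2 - t1) *: w.
  by rewrite scalerBl -e1 -e2; apply/rowP => j; rewrite !mxE; ring.
rewrite (sgZ sg) ?subr_ge0// w1 mulr1.
move: c1; rewrite c2 e1 e2 !(sgZ sg)// w1 !mulr1; lra.
Qed.

Lemma closest_neq x z : U x -> open U -> rho_closest x z -> x - z != 0.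
Proof.
move=> Ux oU [[_ nU] _]; rewrite subr_eq0; apply/eqP => xz; apply: nU.
by rewrite -xz /interior; exact: open_nbhs_nbhs.
Qed.

(** On the compact set of boundary points at distance at least [e] from [z], the cost at [y] exceeds
    [rho y] by some [q > 0]. Moving [y] by less than [q / (2 m)] changes costs and [rho] by less
    than [q / 2] each. *)
Lemma closest_stable y z : (forall z', rho_closest y z' -> z' = z) ->
  forall e : R, 0 < e -> exists2 d : R, 0 < d & forall x z',
    `|x - y| < d -> rho_closest x z' -> `|z' - z| < e.
Proof.
move=> uz e e0.
have cz : rho_closest y z by have [z' cz'] := rho_attained y; rewrite -(uz z').
pose D := boundary U `&` [set z' | e <= `|z' - z|].
have Dc : compact D.
  apply: compact_closedI => //.
  have cn : continuous (fun z' : 'rV[R]_n => `|z' - z|).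
    move=> a; apply/continuous_distP => e' e'0; exists e' => // b ba.
    apply: le_trans (ltW ba); apply: le_trans (ler_dist_dist _ _) _.
    by rewrite opprB addrA subrK.
  exact: ((continuous_closedP _).1 cn _ (@closed_ge R e)).
have [[d0 Dd0]|D0] := pselect (D !=set0); last first.
  exists 1 => // x z' _ [Uz' _]; rewrite ltNge; apply/negP => ez.
  by apply: D0; exists z'.
have [c + Hc] := EVT_min_rV (ex_intro _ d0 Dd0) Dc
  (continuous_subspaceT (@cost_continuous y)).
rewrite inE => -[Uc ec].
have gap : rho y < g (y - c) + phi c.
  rewrite lt_neqAle rho_le// andbT; apply/eqP => yc.
  have /uz cz' : rho_closest y c by [].
  by move: ec; rewrite /= cz' subrr normr0 leNgt e0.
pose q := g (y - c) + phi c - rho y; have q0 : 0 < q by rewrite subr_gt0.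
exists (q / (2 * m)); first by rewrite divr_gt0// mulr_gt0.
move=> x z' xy cz'; rewrite ltNge; apply/negP => ez.
have Uz' := cz'.1.
have h1 : g (y - c) + phi c <= g (y - z') + phi z'.
  by apply: Hc; rewrite inE; split.
have h2 : g (y - z') <= g (x - z') + m * `|x - y|.
  by have := sg_lip sg (y - z') (x - z'); rewrite opprB addrA subrK distrC; lra.
have h3 := rho_sub_le x y; have h4 := sg_le_norm sg (x - y).
move: (cz'.2) => h5; move: xy; rewrite ltr_pdivlMr ?mulr_gt0//.
by rewrite /q; lra.
Qed.

(** The normal [p] is taken at a closest point [zh] of the moved point, so that convexity of [g]
    gives a gain of at least [h p.w]. Stability puts [zh] near [z], whence [p.w] is near 1. *)
Lemma rho_ascent x z w t e (eta : R) :
  rho_closest x z -> (forall z', rho_closest x z' -> z' = z) ->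
  0 < t -> x - z = t *: w -> g w = 1 -> 0 < eta -> 0 < e ->
  exists2 h : R, 0 < h < e & rho x + (1 - eta) * h < rho (x + h *: w).
Proof.
move=> cz uz t0 xz w1 eta0 e0.
(* [D |zh - z|] bounds the total loss in [g u] and in [p.(zh - z)]; [q] keeps it below
   [eta t / 2]. *)
pose D := m * n%:R + m; have D0 : 0 < D by rewrite ltr_wpDl// mulr_ge0// ltW.
pose q := eta * t / (2 * D).
pose q' := Num.min q (t / (2 * m)).
have q0 : 0 < q' by rewrite lt_min !divr_gt0 ?mulr_gt0.
have [d d0 Hd] := closest_stable uz q0.
pose h := Num.min (e / 2) (d / (2 * m)).
have h0 : 0 < h by rewrite lt_min !divr_gt0 ?mulr_gt0.
exists h.
  rewrite h0 /=; apply: (@le_lt_trans _ _ (e / 2)); first by rewrite ge_min lexx.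
  by rewrite ltr_pdivrMr// mulr_natr mulr2n ltrDl.
have wm : `|w| <= m by have := norm_le_sg sg w; rewrite w1 mulr1.
have [zh czh] := rho_attained (x + h *: w).
have xh : `|x + h *: w - x| < d.
  rewrite [x + _]addrC addrK normrZ gtr0_norm//.
  apply: (@le_lt_trans _ _ (h * m)); first by rewrite ler_pM2l.
  have : h <= d / (2 * m) by rewrite ge_min lexx orbT.
  by rewrite ler_pdivlMr ?mulr_gt0//; lra.
have := Hd _ _ xh czh; rewrite lt_min => /andP[zq zt].
pose u := x - zh.
have gut : t - m * `|zh - z| <= g u.
  have gxz : g (x - z) = t by rewrite xz (sgZ sg) ?(ltW t0)// w1 mulr1.
  have := sg_lip sg (x - z) u; rewrite gxz.
  have -> : x - z - u = zh - z by apply/rowP => j; rewrite !mxE; ring.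
  by lra.
have mzt : m * `|zh - z| < t / 2.
  by move: zt; rewrite ltr_pdivlMr ?mulr_gt0//; lra.
have gu0 : 0 < g u by lra.
have u0 : u != 0.
  by apply: contraTneq gu0 => ->; rewrite (sg0 sg) ltxx.
have [w' w'1 uE] := sg_unit sg u0.
have [p [pw pg pm _ _]] := sg_normal sg w'1.
have pu : dot p u = g u by rewrite {1}uE dotZr pw mulr1.
have xhE : x + h *: w - zh = u + h *: w by rewrite addrAC.
have A1 : rho x + h * dot p w <= rho (x + h *: w).
  rewrite czh.2 xhE; apply: le_trans (_ : g u + phi zh + h * dot p w <= _).
    by rewrite lerD2r; exact: rho_le czh.1.
  by have := pg (u + h *: w); rewrite dotDr dotZr pu; lra.
apply: lt_le_trans A1; rewrite ltrD2l mulrC ltr_pM2l//.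
rewrite -(ltr_pM2l t0) -dotZr -xz.
have -> : x - z = u + (zh - z) by rewrite /u addrA subrK.
rewrite dotDr pu.
have : `|dot p (zh - z)| <= n%:R * m * `|zh - z|.
  by apply: le_trans (dot_le _ _) _; rewrite mulrA ler_wpM2r// ler_wpM2l.
move: zq; rewrite ltr_pdivlMr ?mulr_gt0// /D => zq.
by rewrite ler_norml => /andP[? _]; have : 0 < eta * t by [rewrite mulr_gt0]; lra.
Qed.

(* A maximizer of [rho y - (1 - eta) g (y - x)] over the gauge ball of radius [s]
   centred at [x] lies on the sphere, since from an inner point one can still
   climb along its ray. Letting [eta] tend to [0], some [y] on the sphere has
   [rho y = rho x + s]; this forces equality in the triangle inequality for
   [y - x] and [x - z], hence [y = x + s *: w]. *)
Lemma rho_extend x z w t e s : open U ->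
  (forall y, `|y - x| < e -> U y) ->
  (forall y, `|y - x| < e -> forall z1 z2,
     rho_closest y z1 -> rho_closest y z2 -> z1 = z2) ->
  rho_closest x z -> 0 < t -> x - z = t *: w -> g w = 1 ->
  0 < s -> m * s < e -> rho (x + s *: w) = rho x + s.
Proof.
move=> oU Ue unique cz t0 xz w1 s0 mse.
pose S := [set y | g (y - x) <= s].
have cg : continuous (fun y => g (y - x)).
  apply: (lip_continuous sg (f := fun y => g (y - x))) => a b.
  by apply: le_trans (sg_lip sg _ _) _; rewrite opprB addrA subrK.
have Sc : compact S.
  apply: bounded_closed_compact; last first.
    exact: ((continuous_closedP _).1 cg _ (@closed_le R s)).
  exists (`|x| + m * s); split; first exact: num_real.
  move=> M HM y Sy; apply: le_trans (ltW HM).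
  rewrite -[y](subrK x) addrC; apply: le_trans (ler_normD _ _) _.
  by rewrite lerD2l; apply: le_trans (norm_le_sg sg _) _; rewrite ler_pM2l.
have Sx : S x by rewrite /S /= subrr (sg0 sg) ltW.
have Se y : S y -> `|y - x| < e.
  move=> Sy; apply: le_lt_trans (norm_le_sg sg _) _.
  by apply: le_lt_trans mse; rewrite ler_pM2l.
have approx eta : 0 < eta -> exists2 y, S y & rho x + (1 - eta) * s <= rho y.
  move=> eta0; have [eta1|/ltW eta1] := leP eta 1; last first.
    by exists x => //; rewrite gerDl mulr_le0_ge0 ?subr_le0// ltW.
  pose f y := rho y - (1 - eta) * g (y - x).
  have cf : continuous f.
    move=> y; apply: (@cvgB _ _ _ (nbhs y)); first exact: rho_continuous.
    by apply: (@cvgMr _ _ (nbhs y)); exact: cg.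
  have [y + Hy] := EVT_max_rV (ex_intro _ x Sx) Sc (continuous_subspaceT cf).
  rewrite inE => Sy; exists y => //.
  have fx : f x <= f y by apply: Hy; rewrite inE.
  have fxE : f x = rho x by rewrite /f subrr (sg0 sg) mulr0 subr0.
  suff gs : g (y - x) = s by move: fx; rewrite fxE /f gs; lra.
  apply/le_anti; rewrite [g _ <= s]Sy /= leNgt; apply/negP => gys.
  have [zy czy] := rho_attained y.
  have Uy := Ue y (Se y Sy).
  have yz0 := closest_neq Uy oU czy.
  have [v v1 yE] := sg_unit sg yz0.
  have uy z' : rho_closest y z' -> z' = zy.
    by move=> cz'; apply: unique cz' czy; exact: Se.
  have e'0 : 0 < s - g (y - x) by rewrite subr_gt0.
  have [h /andP[h0 hs] Hh] :=
    rho_ascent czy uy (sg_pos sg yz0) yE v1 eta0 e'0.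
  have gyh : g (y + h *: v - x) <= g (y - x) + h.
    rewrite addrAC; apply: le_trans (sgD sg _ _) _.
    by rewrite lerD2l (sgZ sg) ?(ltW h0)// v1 mulr1.
  have Syh : S (y + h *: v).
    by rewrite /S /=; apply: le_trans gyh _; lra.
  have fyh : f (y + h *: v) <= f y by apply: Hy; rewrite inE.
  have : (1 - eta) * g (y + h *: v - x) <= (1 - eta) * (g (y - x) + h).
    by rewrite ler_wpM2l ?subr_ge0.
  by move: fyh; rewrite /f; lra.
have [y + Hy] := EVT_max_rV (ex_intro _ x Sx) Sc
  (continuous_subspaceT rho_continuous).
rewrite inE => Sy.
(* The maximum of [rho] itself dominates all the approximate points; [eta = a / s] costs exactly
   [a]. *)
have rys : rho x + s <= rho y.
  apply/ler_addgt0Pr => a a0.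
  have [|y' Sy' Hy'] := approx (a / s); first by rewrite divr_gt0.
  have : rho y' <= rho y by apply: Hy; rewrite inE.
  have : a / s * s = a by rewrite divfK// gt_eqF.
  by lra.
have yzE : y - z = (y - x) + t *: w by rewrite -xz addrA subrK.
have gtw : g (t *: w) = t by rewrite (sgZ sg) ?(ltW t0)// w1 mulr1.
have rxE : rho x = t + phi z by rewrite cz.2 xz gtw.
have H1 := rho_le y cz.1.
have H2 := sgD sg (y - x) (t *: w); rewrite -yzE gtw in H2.
have Sy' : g (y - x) <= s := Sy.
have gyx : g (y - x) = s by lra.
have gyz : g (y - z) = s + t by lra.
have st0 : 0 < s + t by rewrite addr_gt0.
have yz0 : y - z != 0.
  by apply: contraTneq st0 => yz; rewrite -gyz yz (sg0 sg) ltxx.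
have [w' w'1 yzE'] := sg_unit sg yz0.
have [p np] := sg_normal sg w'1; have [pw pg _ _ _] := np.
have P1 : dot p (y - x) + t * dot p w = s + t.
  by rewrite -dotZr -dotDr -yzE {1}yzE' dotZr pw mulr1.
have P2 := pg (y - x); have P3 := pg w; rewrite w1 in P3.
have P3' : t * dot p w <= t by rewrite ger_pMr.
have P4 : dot p (y - x) = g (y - x) by lra.
have P5 : dot p w = g w.
  rewrite w1; have : t * dot p w = t * 1 by lra.
  by move/(mulfI (lt0r_neq0 t0)).
have := sg_additive_eq np P5; rewrite w1 scale1r => ww'.
have := sg_additive_eq np P4; rewrite gyx -ww' => yxE.
have -> : x + s *: w = y by rewrite -yxE addrC subrK.
by lra.
Qed.

Lemma rho_lower x w p s h : 0 < s -> g w = 1 -> gauge_normal g m w p ->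
  rho (x + s *: w) = rho x + s ->
  rho x + dot p h - m / s * `|h| ^+ 2 <= rho (x + h).
Proof.
move=> s0 w1 [_ _ _ pU _] ext.
have := rho_sub_le (x + s *: w) (x + h); rewrite ext.
have -> : x + s *: w - (x + h) = s *: w + (- h).
  by rewrite opprD addrACA subrr add0r.
by have := pU s (- h) s0; rewrite dotNr normrN; lra.
Qed.

Lemma rho_C11 x e : open U -> 0 < e ->
  (forall y, `|y - x| < e -> U y) ->
  (forall y, `|y - x| < e -> forall z1 z2,
     rho_closest y z1 -> rho_closest y z2 -> z1 = z2) ->
  exists V, [/\ open V, V x & holder_class 1 1 V rho].
Proof.
move=> oU e0 Ue unique.
have e20 : 0 < e / 2 by rewrite divr_gt0.
(* The gauge ball of radius [s] then has norm radius at most [e / 4], so extension stays in the good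
   ball. *)
pose s := e / (4 * m); have s0 : 0 < s by rewrite divr_gt0// mulr_gt0.
have mse : m * s < e / 2.
  rewrite /s (_ : m * _ = e / 4); first by lra.
  by field; rewrite gt_eqF.
exists (ball x (e / 2)); split; [exact: ball_open|exact: ballxx|].
pose C := m / s + m / (e / (2 * m)).
apply: (@C11_of_paraboloids _ _ _ _ C); first exact: ball_open.
move=> y; rewrite -ball_normE /= distrC => yx.
have near y' : `|y' - y| < e / 2 -> `|y' - x| < e.
  move=> y'y; rewrite -(subrKA y); apply: le_lt_trans (ler_normD _ _) _; lra.
have [z cz] := rho_attained y.
have Uy : U y by apply: Ue; lra.
have yz0 := closest_neq Uy oU cz.
have [w w1 yE] := sg_unit sg yz0.
have [p np] := sg_normal sg w1.
set t := g (y - z) in yE; have t0 : 0 < t := sg_pos sg yz0.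
(* A closest point nearer than this would lie in the open set [U]; thus the upper curvature [m / t]
   is bounded uniformly in [y]. *)
have te : e / (2 * m) <= t.
  rewrite ler_pdivrMr ?mulr_gt0// leNgt; apply/negP => te.
  have : U z.
    apply/Ue/near; rewrite distrC; apply: le_lt_trans (norm_le_sg sg _) _.
    by rewrite -/t; lra.
  by move: cz.1 => [_ + Uz]; apply; rewrite /interior; exact: open_nbhs_nbhs.
have ext : rho (y + s *: w) = rho y + s.
  apply: (rho_extend oU _ _ cz t0 yE w1 s0 mse) => y' y'y; first exact/Ue/near.
  exact/unique/near.
exists p => h.
have U1 := rho_upper h cz t0 yE w1 np; have L1 := rho_lower h s0 w1 np ext.
have h0 : 0 <= `|h| ^+ 2 by rewrite exprn_ge0.
have a0 : 0 <= m / s * `|h| ^+ 2 by rewrite mulr_ge0// divr_ge0// ltW.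
have ue : m / t * `|h| ^+ 2 <= m / (e / (2 * m)) * `|h| ^+ 2.
  rewrite ler_wpM2r// ler_pM2l// lef_pV2 ?posrE//.
  by rewrite divr_gt0// mulr_gt0.
have b0 : 0 <= m / t * `|h| ^+ 2 by rewrite mulr_ge0// divr_ge0// ltW.
by rewrite /C mulrDl ler_norml; apply/andP; split; lra.
Qed.

Lemma ridge0_not_C11 x z1 z2 V : open U -> U x -> z1 <> z2 ->
  rho_closest x z1 -> rho_closest x z2 -> V x -> ~ holder_class 1 1 V rho.
Proof.
move=> oU Ux z12 c1 c2 Vx [_ H].
have x1 := closest_neq Ux oU c1; have x2 := closest_neq Ux oU c2.
have [w1 w11 E1] := sg_unit sg x1; have [w2 w21 E2] := sg_unit sg x2.
have [p1 n1] := sg_normal sg w11; have [p2 n2] := sg_normal sg w21.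
have pE z w p : rho_closest x z -> x - z != 0 -> x - z = g (x - z) *: w ->
    g w = 1 -> gauge_normal g m w p -> forall i, partial i rho x = p ord0 i.
  move=> cz xz E w_1 np i; apply: (@derive_of_upper _ _ _ _ _ _ (m / g (x - z))).
    by have [+ _] := H i; exact.
  move=> h; have := rho_upper (h *: delta_mx ord0 i) cz (sg_pos sg xz) E w_1 np.
  by rewrite dotZr dot_delta normrZ norm_delta_rV mulr1 real_normK// num_real.
have p12 : p1 = p2.
  apply/rowP => i; rewrite -(pE _ _ _ c1 x1 E1 w11 n1 i).
  exact: pE c2 x2 E2 w21 n2 i.
have [pw1 _ _ _ _] := n1; have [pw2 _ _ _ _] := n2.
(* The common normal attains the gauge at both unit directions, so they coincide and both closest
   points lie on one ray. *)
have := sg_additive_eq n2 (u := w1); rewrite -p12 pw1 w11 scale1r => /(_ erefl) w12.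
apply: z12; rewrite -w12 in E2.
exact: (closest_same_direction c1 c2 w11 (sg_ge0 sg _) (sg_ge0 sg _) E1 E2).
Qed.

(* The competitor is [z + T *: v] slid along the axis [i] onto the boundary. *)
Lemma tangent_critical x z w p t F i s v : C1 phi -> C1 F -> s * s = 1 ->
  (forall y t', F (y + t' *: delta_mx ord0 i) = F y - s * t') ->
  (\forall y \near z, F y = 0 -> boundary U y) -> F z = 0 ->
  rho_closest x z -> 0 < t -> x - z = t *: w -> g w = 1 ->
  gauge_normal g m w p ->
  dot (grad F z) v = 0 -> dot (p - grad phi z) v <= 0.
Proof.
move=> cphi cF ss Fi /near_distP[r1 r10 H1] Fz cz t0 xz w1 [_ _ _ pU _] Nv.
set q := p - grad phi z; apply/ler_addgt0Pr => E E0; rewrite add0r.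
pose V := `|v| + 1; have V0 : 0 < V by rewrite ltr_wpDl.
have qV : 0 < 2 * (`|q| + V) by rewrite mulr_gt0// ltr_wpDl.
pose e := Num.min 1 (E / (2 * (`|q| + V))).
have e0 : 0 < e by rewrite lt_min ltr01 divr_gt0.
have e1 : e <= 1 by rewrite ge_min lexx.
have eE : e * (2 * (`|q| + V)) <= E by rewrite -ler_pdivlMr// ge_min lexx orbT.
have /is_derive_epsP/(_ e e0)/near_distP[r2 r20 H2] := C1_is_derive z v cF.
have [r3 r30 H3] := C1_strict z cphi e0.
have k0 : 0 < 2 * (m / t * V ^+ 2).
  by rewrite mulr_gt0// mulr_gt0 ?divr_gt0 ?exprn_gt0.
(* [T] keeps the competitor within reach of every local estimate and its quadratic gauge term below
   [E / 2]; [e] does the same for the first order errors. *)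
pose T := Num.min (Num.min (r1 / (2 * V)) (r2 / 2))
  (Num.min (r3 / (2 * V)) (E / (2 * (m / t * V ^+ 2)))).
have V20 : 0 < 2 * V by rewrite mulr_gt0.
have T0 : 0 < T by rewrite !lt_min !divr_gt0.
have T1 : T * (2 * V) <= r1 by rewrite -ler_pdivlMr// !ge_min lexx.
have T2 : T < r2.
  apply: (@le_lt_trans _ _ (r2 / 2)); first by rewrite !ge_min lexx orbT.
  by rewrite ltr_pdivrMr// mulr_natr mulr2n ltrDl.
have T3 : T * (2 * V) <= r3 by rewrite -ler_pdivlMr// !ge_min lexx !orbT.
have T4 : T * (2 * (m / t * V ^+ 2)) <= E.
  by rewrite -ler_pdivlMr// !ge_min lexx !orbT.
clearbody e T.
have s1 : `|s| = 1.
  by apply/eqP; rewrite -sqrp_eq1// expr2 -normrM ss normr1.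
have := H2 T; rewrite subr0 gtr0_norm// => /(_ T2).
rewrite Fz subr0 Nv scaler0 subr0 [T *: v + z]addrC => FT.
pose c0 := s * F (z + T *: v).
have sgT : `|c0| <= e * T by rewrite normrM s1 mul1r.
pose d := T *: v + c0 *: delta_mx ord0 i.
have dV : `|d| <= T * V.
  apply: le_trans (ler_normD _ _) _.
  rewrite [`|T *: v|]normrZ [`|c0 *: _|]normrZ norm_delta_rV mulr1.
  rewrite gtr0_norm// /V mulrDr mulr1 lerD2l.
  by apply: le_trans sgT _; rewrite ler_piMl// ltW.
have TV0 : 0 < T * V by rewrite mulr_gt0.
have Fd : F (z + d) = 0.
  by rewrite /d addrA Fi mulrA ss mul1r subrr.
have Ud : boundary U (z + d).
  by apply: H1 Fd; rewrite [z + d]addrC addrK; lra.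
have A1 := rho_closest_le cz Ud.
have A2 := pU t (- d) t0.
have xzd : x - (z + d) = t *: w + - d by rewrite opprD addrA xz.
have gxz : g (x - z) = t by rewrite xz (sgZ sg) ?(ltW t0)// w1 mulr1.
rewrite xzd gxz in A1; rewrite dotNr normrN in A2.
have zr3 : `|z - z| < r3 by rewrite subrr normr0.
have dr3 : `|z + d - z| < r3 by rewrite [z + d]addrC addrK; lra.
have := H3 _ _ zr3 dr3; rewrite ler_norml => /andP[_ A3].
have A4 : dot q d <= e * `|d| + m / t * `|d| ^+ 2.
  by rewrite dotBl; lra.
have A5 : dot q d = T * dot q v + c0 * q ord0 i.
  by rewrite /d dotDr !dotZr dot_delta.
have A6 : `|c0 * q ord0 i| <= e * T * `|q|.
  by rewrite normrM ler_pM// coord_le_norm.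
have A7 : m / t * `|d| ^+ 2 <= m / t * (T * V) ^+ 2.
  by rewrite ler_pM2l ?divr_gt0// lerXn2r ?nnegrE// ltW.
have A8 : e * `|d| <= e * (T * V) by rewrite ler_pM2l.
move: A6; rewrite ler_norml => /andP[A6 _].
have A9 : T * dot q v <= T * (e * (`|q| + V) + m / t * T * V ^+ 2).
  move: A4; rewrite A5 => A4; move: A7; rewrite exprMn => A7; lra.
move: A9; rewrite ler_pM2l// => A9; lra.
Qed.

(** Criticality applies to both [v] and [-v]. The multiplier is read off along the axis [i], where
    the gradient of [F] is [-s]; this is what bounds it by [|p - grad phi z|]. *)
Lemma lagrange x z w p t F i s : C1 phi -> C1 F -> s * s = 1 ->
  (forall y t', F (y + t' *: delta_mx ord0 i) = F y - s * t') ->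
  (grad F z) ord0 i = - s ->
  (\forall y \near z, F y = 0 -> boundary U y) -> F z = 0 ->
  rho_closest x z -> 0 < t -> x - z = t *: w -> g w = 1 ->
  gauge_normal g m w p ->
  exists2 l : R, `|l| <= `|p - grad phi z| & p - grad phi z = l *: grad F z.
Proof.
move=> cphi cF ss Fi gFi bdF Fz cz t0 xz w1 np.
have crit v : dot (grad F z) v = 0 -> dot (p - grad phi z) v = 0.
  move=> Nv; apply/le_anti.
  rewrite (tangent_critical cphi cF ss Fi bdF Fz cz t0 xz w1 np)//=.
  rewrite -oppr_le0 -dotNr.
  by rewrite (tangent_critical cphi cF ss Fi bdF Fz cz t0 xz w1 np)// dotNr Nv oppr0.
set q := p - _ in crit *.
exists (- s * q ord0 i).
  have s1 : `|s| = 1.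
    by apply/eqP; rewrite -sqrp_eq1// expr2 -normrM ss normr1.
  by rewrite normrM normrN s1 mul1r coord_le_norm.
apply/rowP => k; rewrite !mxE.
(* Tangent because [s * s = 1]: the correction along axis [i] cancels the normal component of axis
   [k]. *)
have := crit (delta_mx ord0 k + (s * (grad F z) ord0 k) *: delta_mx ord0 i).
rewrite !dotDr !dotZr !dot_delta gFi mulrN mulrAC ss mul1r subrr => /(_ erefl).
rewrite !mxE => /eqP; rewrite addr_eq0 => /eqP ->; ring.
Qed.

(** Closest points of [x] near [z0] are near [z0] by stability. At [z1] the multiplier rule aligns
    [p - grad phi z1] with the normal, and [th < 1] makes the ray transversal. Equal costs turn the
    gap [g u - p.u] at [u = x - z2] into second order terms, and [transversal_eq0] concludes. *)
Lemma boundary_unique z0 F i s (th : R) : open U -> chart U z0 F i s ->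
  boundary U z0 -> C2 phi -> th < 1 ->
  (forall u, dot (grad phi z0) u <= th * g u) ->
  exists2 d : R, 0 < d & forall x, `|x - z0| < d -> U x ->
    forall z1 z2, rho_closest x z1 -> rho_closest x z2 -> z1 = z2.
Proof.
move=> oU UF Uz0 cphi th1 Hth; have [cF ss Fi nF] := UF.
have [r1 r10 H1] := (near_distP _ _).1 nF.
have [CF [r2 [CF0 r20 H2]]] := C2_quadratic z0 cF.
have [CP [r3 [CP0 r30 H3]]] := C2_quadratic z0 cphi.
have [r4 r40 H4] := C2_grad_continuous z0 cF (@ltr01 R).
(* One half of [1 - th] absorbs the variation of [grad phi] near [z0]; the other remains as
   transversality. *)
pose b := (1 - th) / 2; have b0 : 0 < b by rewrite divr_gt0// subr_gt0.
have nm0 : 0 < n%:R * m + 1 by rewrite ltr_wpDl// mulr_ge0// ltW.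
pose e5 := Num.min 1 (b / (n%:R * m + 1)).
have e50 : 0 < e5 by rewrite lt_min ltr01 divr_gt0.
have [r5 r50 H5] := C2_grad_continuous z0 cphi e50.
have e51 : e5 <= 1 by rewrite ge_min lexx.
have e5b : e5 * (n%:R * m + 1) <= b.
  by rewrite -ler_pdivlMr// ge_min lexx orbT.
clearbody e5.
have thE : th = 1 - 2 * b by rewrite /b; field.
clearbody b.
pose L := `|grad F z0| + 1; have L0 : 0 < L by rewrite ltr_wpDl.
have LE : L = `|grad F z0| + 1 by [].
clearbody L.
(* [A] bounds the multiplier [l]; from [b <= l N.w] follows [|N.w| >= b / A], which is [be]. *)
pose A := m + (`|grad phi z0| + 1).
have A0 : 0 < A by rewrite addr_gt0// ltr_wpDl.
have AE : A = m + (`|grad phi z0| + 1) by [].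
clearbody A.
pose be := b / A; have be0 : 0 < be by rewrite divr_gt0.
have beE : be * A = b by rewrite divfK// gt_eqF.
clearbody be.
pose C3 := A * CF + CP; have C30 : 0 <= C3 by rewrite addr_ge0// mulr_ge0// ltW.
pose C4 := 2 * (1 + m * (n%:R * L / be)).
have C40 : 0 < C4.
  by rewrite mulr_gt0// ltr_wpDr// mulr_ge0 ?(ltW m0)// divr_ge0 ?(ltW be0)//
    mulr_ge0// ltW.
have K0 : 0 < 2 * m * (m * (C3 + 1) * C4 ^+ 2).
  have C310 : 0 < C3 + 1 by rewrite ltr_wpDl.
  have C42 : 0 < C4 ^+ 2 by exact: exprn_gt0.
  apply: mulr_gt0; first by apply: mulr_gt0.
  by apply: mulr_gt0 => //; apply: mulr_gt0.
have J0 : 0 < 4 * (m * CF / be + 1).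
  by rewrite mulr_gt0// ltr_wpDl// divr_ge0 ?(ltW be0)// mulr_ge0// ltW.
pose eta := Num.min (Num.min r1 (Num.min r2 r3)) (Num.min (Num.min r4 r5)
  (Num.min (1 / (4 * (m * CF / be + 1)))
    (1 / (2 * m * (m * (C3 + 1) * C4 ^+ 2))))).
have eta0 : 0 < eta by rewrite !lt_min r10 r20 r30 r40 r50 !divr_gt0.
have [et1 et2 et3] : [/\ eta <= r1, eta <= r2 & eta <= r3].
  by rewrite !ge_min !lexx !orbT.
have [et4 et5] : eta <= r4 /\ eta <= r5 by rewrite !ge_min !lexx !orbT.
have et6 : eta * (4 * (m * CF / be + 1)) <= 1.
  by rewrite -ler_pdivlMr// !ge_min lexx !orbT.
have et7 : eta * (2 * m * (m * (C3 + 1) * C4 ^+ 2)) <= 1.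
  by rewrite -ler_pdivlMr// !ge_min lexx !orbT.
clearbody eta.
(* Staying at [z0] costs [phi z0], strictly less than any other boundary point by [phi_strict]. *)
have uz0 z' : rho_closest z0 z' -> z' = z0.
  move=> cz'; apply: contrapT => /eqP; rewrite eq_sym => /phi_strict.
  rewrite ltNge; apply/negP; rewrite negbK lerBrDr.
  by have := rho_closest_le cz' Uz0; rewrite subrr (sg0 sg) add0r.
have [d d0 Hd] := closest_stable uz0 eta0.
exists (Num.min d eta); first by rewrite lt_min d0.
move=> x; rewrite lt_min => /andP[xd xeta] Ux z1 z2 c1 c2.
have n1 := Hd _ _ xd c1; have n2 := Hd _ _ xd c2.
have xz1 := closest_neq Ux oU c1.
have [w w1 xE] := sg_unit sg xz1.
have [p np] := sg_normal sg w1; have [pw pg pm pU pL] := np.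
set t := g (x - z1) in xE; have t0 : 0 < t := sg_pos sg xz1.
have Fz1 : F z1 = 0.
  by have [_ [+ _]] := H1 _ (lt_le_trans n1 et1); apply; exact: c1.1.
have Fz2 : F z2 = 0.
  by have [_ [+ _]] := H1 _ (lt_le_trans n2 et1); apply; exact: c2.1.
have bdF : \forall y \near z1, F y = 0 -> boundary U y.
  apply/near_distP; exists (r1 - `|z1 - z0|) => [|y yz1 Fy].
    by rewrite subr_gt0; exact: lt_le_trans et1.
  have [|_ [_ +]] := H1 y; last exact.
  rewrite -(subrKA z1); apply: le_lt_trans (ler_normD _ _) _.
  by rewrite -ltrBrDr.
have [l lq qE] := lagrange cphi.1 cF.1 ss Fi (chart_grad z1 UF) bdF Fz1 c1 t0 xE
  w1 np.
set q := p - grad phi z1 in lq qE; set N := grad F z1 in qE.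
have dphi : `|grad phi z1 - grad phi z0| <= e5 by apply: H5; exact: lt_le_trans et5.
have NL : `|N| <= L.
  by rewrite LE; apply: ler_norm_near; exact: H4 (lt_le_trans n1 et4).
have lA : `|l| <= A.
  apply: le_trans lq _; apply: le_trans (ler_normB _ _) _; rewrite AE lerD//.
  by apply: ler_norm_near; exact: le_trans e51.
have wm : `|w| <= m by have := norm_le_sg sg w; rewrite w1 mulr1.
have qw : b <= dot q w.
  have h1 : `|dot (grad phi z1 - grad phi z0) w| <= n%:R * (e5 * m).
    by apply: le_trans (dot_le _ _) _; apply: ler_wpM2l => //;
      exact: (ler_pM (normr_ge0 _) (normr_ge0 _) dphi wm).
  have h2 := Hth w; rewrite w1 mulr1 in h2.
  have h3 : n%:R * (e5 * m) <= b.
    by apply: le_trans e5b; rewrite mulrCA ler_pM2l// lerDl.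
  have h4 := le_trans (ler_norm _) (le_trans h1 h3).
  rewrite dotBl lerBlDr in h4.
  rewrite /q dotBl pw lerBrDr; apply: le_trans (lerD (lexx b) h4) _.
  apply: le_trans (lerD (lexx b) (lerD (lexx b) h2)) _.
  by rewrite thE le_eqVlt; apply/orP; left; apply/eqP; ring.
have Nw : be <= `|dot N w|.
  have h : b <= A * `|dot N w|.
    apply: le_trans qw _; rewrite qE dotZl; apply: le_trans (ler_norm _) _.
    by rewrite normrM ler_wpM2r.
  by rewrite -(ler_pM2l A0) mulrC beE.
have := c2.2; rewrite c1.2 => bal.
have z2E : z1 + (z2 - z1) = z2 by rewrite addrC subrK.
have Nd : `|dot N (z2 - z1)| <= CF * `|z2 - z1| ^+ 2.
  have := H2 z1 (z2 - z1) (lt_le_trans n1 et2).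
  by rewrite z2E Fz1 Fz2 subrr sub0r normrN; apply; exact: lt_le_trans et2.
have Pd : `|phi z2 - phi z1 - dot (grad phi z1) (z2 - z1)|
    <= CP * `|z2 - z1| ^+ 2.
  have := H3 z1 (z2 - z1) (lt_le_trans n1 et3).
  by rewrite z2E; apply; exact: lt_le_trans et3.
have dist : `|z2 - z1| <= 2 * eta.
  rewrite -(subrKA z0) mulr_natl mulr2n; apply: le_trans (ler_normD _ _) _.
  by rewrite [`|z0 - z1|]distrC lerD// ltW.
have uE : x - z2 = t *: w - (z2 - z1).
  by rewrite -xE opprB addrA addrNK.
have small : g (x - z2) <= m * (2 * eta).
  apply: le_trans (sg_le_norm sg _) _; rewrite ler_pM2l//.
  rewrite -(subrKA z0) mulr_natl mulr2n; apply: le_trans (ler_normD _ _) _.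
  by rewrite [`|z0 - z2|]distrC lerD// ltW.
(* Eliminating [t] by the equality of costs and [p] by the multiplier rule leaves only the
   remainders of [F] and [phi]. *)
have gap : g (x - z2) - dot p (x - z2) <= (A * CF + CP) * `|z2 - z1| ^+ 2.
  have -> : g (x - z2) - dot p (x - z2) = l * dot N (z2 - z1)
      - (phi z2 - phi z1 - dot (grad phi z1) (z2 - z1)).
    have -> : dot p (x - z2) = t - dot p (z2 - z1).
      by rewrite uE (dotBr p (t *: w)) dotZr pw mulr1.
    have -> : t = g (x - z2) + phi z2 - phi z1 by rewrite -bal addrK.
    by rewrite -dotZl -qE /q dotBl; ring.
  apply: le_trans (ler_norm _) _; apply: le_trans (ler_normB _ _) _.
  rewrite mulrDl lerD// -mulrA normrM.
  exact: (ler_pM (normr_ge0 _) (normr_ge0 _) lA Nd).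
apply/esym/eqP; rewrite -subr_eq0; apply/eqP.
exact: (transversal_eq0 sg np w1 uE NL be0 Nw CF0 Nd C30 gap small dist et6 et7).
Qed.

End Rho.

(** * Global consequences of the hypotheses, and the equality of the two sets *)

Lemma gradient_strict_lip {R : realType} {n : nat} (g phi : 'rV[R]_n -> R) m :
  smooth_gauge g m -> C1 phi ->
  (forall x, exists2 t : R, t < 1 & forall u, dot (grad phi x) u <= t * g u) ->
  forall x y, x != y -> phi x - phi y < g (x - y).
Proof.
move=> sg cphi H x y xy.
have gxy : 0 < g (x - y) by apply: (sg_pos sg); rewrite subr_eq0.
pose f (s : R) := phi (y + s *: (x - y)).
have df (s : R) : is_derive s (1 : R) f (dot (grad phi (y + s *: (x - y))) (x - y)).
  exact/is_derive_line/C1_is_derive.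
have cf : {within `[0, 1], continuous f}.
  apply: continuous_subspaceT => s; apply: differentiable_continuous.
  by apply/derivable1_diffP; case: (df s).
have [s _] := MVT_segment ler01 (fun s _ => df s) cf.
rewrite /f scale1r scale0r addr0 subr0 mulr1 [y + _]addrC subrK => ->.
have [t t1 Ht] := H (y + s *: (x - y)).
by apply: le_lt_trans (Ht _) _; rewrite gtr_pMl.
Qed.

Lemma closure_bounded_compact {R : realType} {n : nat} (U : set 'rV[R]_n) :
  bounded_set U -> compact (closure U).
Proof.
move=> /bounded_setP[M M0 HM].
have cB : closed [set x : 'rV[R]_n | `|x| <= M].
  exact: ((continuous_closedP _).1 (@norm_continuous R _) _ (@closed_le R M)).
apply: bounded_closed_compact; last exact: closed_closure.
exists M; split=> [|N MN x /closureS Ux]; first exact: num_real.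
apply: le_trans (ltW MN); have := Ux _ HM.
by rewrite -(closure_id _).1.
Qed.

(** A point of the closure that maximizes one coordinate cannot be interior. It is needed for [rho]
    to be attained. *)
Lemma bounded_boundary_nonempty {R : realType} {n : nat} (U : set 'rV[R]_n) :
  (0 < n)%N -> bounded_set U -> U !=set0 -> boundary U !=set0.
Proof.
move=> n0 bU [x Ux]; pose i := Ordinal n0.
have cdot : continuous (dot (delta_mx ord0 i : 'rV[R]_n)).
  exact: C1_continuous (C2_dot _).1.
have [c + Hc] := EVT_max_rV (ex_intro _ x (subset_closure Ux))
  (closure_bounded_compact bU) (continuous_subspaceT cdot).
rewrite inE => Uc; exists c; split=> // /near_distP[r r0 Hr].
have := Hc (c + (r / 2) *: delta_mx ord0 i).
rewrite inE => /(_ (subset_closure (Hr _ _))).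
rewrite dotDr dotZr dot_delta mxE !eqxx mulr1 gerDl leNgt divr_gt0//.
rewrite [c + _]addrC addrK normrZ norm_delta_rV mulr1 gtr0_norm ?divr_gt0//.
rewrite ltr_pdivrMr// mulr_natr mulr2n ltrDl r0.
by move=> /(_ isT).
Qed.

Theorem proposition3 (R : realType) (n k : nat) (alpha : R)
    (n_gt0 : (0 < n)%N) (k_ge2 : (2 <= k)%N) (alpha01 : 0 <= alpha <= 1)
    (K : set 'rV[R]_n)
    (K_compact : compact K)
    (K_convex : convex_set (K : set (convex_lmodType 'rV[R]_n)))
    (K_int0 : interior K 0)
    (K_boundary : holder_boundary k alpha K)
    (K_curv : forall (x : 'rV[R]_n) (kappa : R),
       boundary K x -> principal_curvature K x kappa -> 0 < kappa)
    (U : set 'rV[R]_n)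
    (U_open : open U) (U_bounded : bounded_set U)
    (U_boundary : holder_boundary k alpha U)
    (phi : 'rV[R]_n -> R)
    (phi_class : holder_class k alpha setT phi)
    (phi_grad : forall x : 'rV[R]_n, gauge (polar K) (grad phi x) < 1) :
  rho_ridge K U phi = closure (rho_ridge0 K U phi).
Proof.
have [r [M body]] := convex_bodyP K_compact K_convex K_int0.
have [m sg] := gauge_smooth k_ge2 K_compact K_convex K_int0 K_boundary K_curv.
have cphi := holder_class_C2 k_ge2 phi_class.
have phi_dual x : exists2 t : R, t < 1 &
    forall u, dot (grad phi x) u <= t * gauge K u.
  have [t [t0 t1 Ht]] := gauge_polar_lt1 (body_outer_gt0 body)
    (body_outer body) (phi_grad x).
  exists t => // u; exact: (dot_le_gauge body u (ltW t0) Ht).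
have phi_strict := gradient_strict_lip sg cphi.1 phi_dual.
have phi_cont := C1_continuous cphi.1.
have bdc : compact (boundary U).
  apply: (subclosed_compact (@boundary_closed _ U)
    (closure_bounded_compact U_bounded)).
  by move=> x [].
have bdne x : U x -> boundary U !=set0.
  by move=> Ux; apply: bounded_boundary_nonempty => //; exists x.
apply/seteqP; split=> [x [Ux nC11]|x xcl].
  apply: contrapT => ncl; apply: nC11.
  have : \forall y \near x, U y /\ ~ closure (rho_ridge0 K U phi) y.
    apply: filterI; first exact: open_nbhs_nbhs.
    by apply: open_nbhs_nbhs; split=> //; exact/closed_openC/closed_closure.
  move=> /near_distP[e e0 He].
  apply: (rho_C11 sg bdc (bdne x Ux) phi_cont U_open e0).
    by move=> y /He[].
  move=> y /He[Uy ny] z1 z2 c1 c2; apply: contrapT => z12; apply: ny.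
  by apply: subset_closure; split=> //; exists z1, z2.
(* [x] may lie outside [U]; this nearby ridge point certifies that [U], hence its boundary, is
   nonempty. *)
have [y0 [[Uy0 _] _]] := xcl setT filterT.
have [Ux|nUx] := pselect (U x).
  split=> // -[V [oV Vx C11]].
  have [y [[Uy [z1 [z2 [z12 c1 c2]]]] Vy]] := xcl V (open_nbhs_nbhs (conj oV Vx)).
  exact: (ridge0_not_C11 sg bdc (bdne y Uy) phi_cont phi_strict U_open Uy z12
    c1 c2 Vy C11).
(* A closure point outside [U] lies on the boundary, where uniqueness in a neighbourhood rules it
   out. *)
exfalso; have bdx : boundary U x.
  split; first by apply: closureS xcl => y [].
  by move=> /interior_subset.
have [F [i [s UF]]] := holder_boundary_chart k_ge2 U_boundary bdx.
have [t t1 Ht] := phi_dual x.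
have [d d0 Hd] := boundary_unique sg bdc (bdne y0 Uy0) phi_cont phi_strict
  U_open UF bdx cphi t1 Ht.
have nd : \forall y \near x, `|y - x| < d by apply/near_distP; exists d.
have [y [[Uy [z1 [z2 [z12 c1 c2]]]] yd]] := xcl _ nd.
exact: z12 (Hd y yd Uy z1 z2 c1 c2).
Qed.
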